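(* Let $\mu_{\mathrm d}\in\mathbb{R}^n$, $\Sigma_{\mathrm d}\in\mathbb{S}_n^{++}$ and $\rho>0$ be given. Consider the soft-constrained covariance steering problem (SCCS): over all collections of vectors $\bar u(0),\dots,\bar u(T-1)\in\mathbb{R}^m$ and matrices $L_t\in\mathbb{R}^{m\times n}$ ($0\le t\le T-1$), $K_{(t,\tau)}\in\mathbb{R}^{m\times n}$ ($0\le\tau\le t\le T-2$), minimize the squared Wasserstein distance $$W^2\big(\mathcal N(\mu_{x(T)},\mathrm{var}_{x(T)}),\,\mathcal N(\mu_{\mathrm d},\Sigma_{\mathrm d})\big)$$ subject to $\mathbb{E}\big[\sum_{t=0}^{T-1}u(t)^{\mathrm T}u(t)\big]-\rho^2\le 0$, where $x$ and $u$ are the state and input processes of the closed-loop system described in the context. Then SCCS is equivalent to the optimization problem $$\begin{aligned}\min_{\bar{\bm u},\bm{\mathcal L},\bm{\mathcal K},\bm\xi}\quad & \big\|\mathbf P_{T+1}(\mathbf G_{\bm u}\bar{\bm u}+\mathbf G_0\mu_0)-\mu_{\mathrm d}\big\|_2^2+\|\bm\xi\|_F^2+\operatorname{tr}(\Sigma_{\mathrm d})-2\big\|\Sigma_{\mathrm d}^{1/2}\bm\xi\big\|_*\\ \text{subject to}\quad & \bm\xi=\bm\zeta(\bm{\mathcal L},\bm{\mathcal K}),\\ & \bar{\bm u}^{\mathrm T}\bar{\bm u}+\operatorname{tr}(\bm{\mathcal K}\mathbf W\bm{\mathcal K}^{\mathrm T})+\operatorname{tr}(\bm{\mathcal L}\Sigma_0\bm{\mathcal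 L}^{\mathrm T})-\rho^2\le 0,\end{aligned}$$ with $\bm\xi\in\mathbb{R}^{n\times q}$. Here equivalence means: under the one-to-one correspondence between controller parameters and triples $(\bar{\bm u},\bm{\mathcal L},\bm{\mathcal K})$ given in the context (with $\bm\xi=\bm\zeta(\bm{\mathcal L},\bm{\mathcal K})$), a collection of parameters is feasible for SCCS if and only if the corresponding $(\bar{\bm u},\bm{\mathcal L},\bm{\mathcal K},\bm\xi)$ is feasible for this problem, and the two objective values then coincide (so the optimal values agree and minimizers correspond to minimizers).
   Context: System. Let $T\ge1$, $A(t)\in\mathbb{R}^{n\times n}$, $B(t)\in\mathbb{R}^{n\times m}$ for $t=0,\dots,T-1$, and $$x(t+1)=A(t)x(t)+B(t)u(t)+w(t),\qquad x(0)=x_0\sim\mathcal N(\mu_0,\Sigma_0),$$ with $\mu_0\in\mathbb{R}^n$, $\Sigma_0\in\mathbb{S}_n^{++}$, where $w(0),\dots,w(T-1)$ are i.i.d. normal random vectors in $\mathbb{R}^n$ with mean $0$ and covariance $W\in\mathbb{S}_n^{+}$, independent of $x_0$. ($\mathbb{S}_n^{+}$, $\mathbb{S}_n^{++}$: symmetric positive semidefinite, resp. positive definite, $n\times n$ matrices; $M^{1/2}$ is the unique positive semidefinite square root of $M\in\mathbb{S}_n^+$.) For a random vector $z$, $\mu_z=\mathbb{E}[z]$ and $\mathrm{var}_z=\mathbb{E}[(z-\mu_z)(z-\mu_z)^{\mathrm T}]$. Squared Wasserstein distance between Gaussians, given by the closed form $$W^2(\mathcal N(\mu_1,\Sigma_1),\mathcal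 N(\mu_2,\Sigma_2))=\|\mu_1-\mu_2\|_2^2+\operatorname{tr}\big(\Sigma_1+\Sigma_2-2(\Sigma_2^{1/2}\Sigma_1\Sigma_2^{1/2})^{1/2}\big).$$ Control policy. For $t=0,\dots,T-1$, $$u(t)=\bar u(t)+L_t(x(0)-\mu_0)+\sum_{\tau=0}^{t-1}K_{(t-1,\tau)}w(\tau)$$ (empty sum for $t=0$), with $\bar u(t)\in\mathbb{R}^m$, $L_t,K_{(t,\tau)}\in\mathbb{R}^{m\times n}$. Stacked parameters. $\bar{\bm u}=[\bar u(0)^{\mathrm T},\dots,\bar u(T-1)^{\mathrm T}]^{\mathrm T}\in\mathbb{R}^{Tm}$; $\bm{\mathcal L}\in\mathbb{R}^{Tm\times n}$ is the vertical stacking of $L_0,\dots,L_{T-1}$; $\bm{\mathcal K}=\begin{bmatrix}\mathbf 0&\mathbf 0\\ \bm K&\mathbf 0\end{bmatrix}\in\mathbb{R}^{Tm\times Tn}$, where $\bm K\in\mathbb{R}^{(T-1)m\times(T-1)n}$ is block lower triangular with $(i,j)$ block ($0\le i,j\le T-2$) equal to $K_{(i,j)}$ if $i\ge j$ and $\mathbf 0$ otherwise. Thus $\bm{\mathcal K}$ ranges over all $T\times T$ block matrices with $m\times n$ blocks that are strictly block lower triangular, and parameters correspond one-to-one to triples $(\bar{\bm u},\bm{\mathcal L},\bm{\mathcal K})$. Stacked system matrices. $\Phi(t,\tau)=A(t-1)\cdots A(\tau)$ for $\tau<t$, $\Phi(t,t)=I$. With block rows indexed by $t=0,\dots,T$ and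 block columns by $\tau=0,\dots,T-1$: $\mathbf G_{\bm u}\in\mathbb{R}^{(T+1)n\times Tm}$ has $(t,\tau)$ block $\Phi(t,\tau+1)B(\tau)$ if $\tau<t$ and $\mathbf 0$ otherwise; $\mathbf G_{\bm w}\in\mathbb{R}^{(T+1)n\times Tn}$ has $(t,\tau)$ block $\Phi(t,\tau+1)$ if $\tau<t$ and $\mathbf 0$ otherwise; $\mathbf G_0\in\mathbb{R}^{(T+1)n\times n}$ has $t$-th block $\Phi(t,0)$. $\mathbf W=\mathrm{bdiag}(W,\dots,W)\in\mathbb{R}^{Tn\times Tn}$. $\mathbf P_{T+1}=[\mathbf 0,\dots,\mathbf 0,I_n]\in\mathbb{R}^{n\times(T+1)n}$. The map $\bm\zeta$. Fix a matrix $\mathbf R\in\mathbb{R}^{(T+1)n\times q}$ with $\mathbf R\mathbf R^{\mathrm T}=\mathrm{bdiag}(\Sigma_0,\mathbf W)$, and set $$\bm\zeta(\bm{\mathcal L},\bm{\mathcal K})=\mathbf P_{T+1}\,[\,\mathbf G_0+\mathbf G_{\bm u}\bm{\mathcal L}\ \ \ \mathbf G_{\bm w}+\mathbf G_{\bm u}\bm{\mathcal K}\,]\,\mathbf R\in\mathbb{R}^{n\times q}.$$ $\|\cdot\|_F$ is the Frobenius norm and $\|\cdot\|_*$ the nuclear norm (sum of singular values). *)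

(* Defs.v *)
From HB Require Import structures.
From mathcomp Require Import all_boot all_order all_algebra.
From mathcomp Require Import polyrcf.
From mathcomp Require Import all_classical all_reals all_analysis.
Set Implicit Arguments.
Unset Strict Implicit.
Unset Printing Implicit Defensive.
Import Order.TTheory GRing.Theory Num.Theory.
Import numFieldNormedType.Exports.

Local Open Scope classical_set_scope.
Local Open Scope ring_scope.

Definition psdmx (R : realType) (n : nat) (M : 'M[R]_n) : Prop :=
  M^T = M /\ forall v : 'cV[R]_n, 0 <= (v^T *m M *m v) 0 0.

Definition pdmx (R : realType) (n : nat) (M : 'M[R]_n) : Prop :=
  M^T = M /\ forall v : 'cV[R]_n, v != 0 -> 0 < (v^T *m M *m v) 0 0.

(* Meaningful for [M] positive semidefinite, where the defining property
   determines the root uniquely. *)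
Definition mxsqrt (R : realType) (n : nat) (M : 'M[R]_n) : 'M[R]_n :=
  xget 0 [set S | psdmx S /\ S *m S = M].

Definition l2norm (R : realType) (n : nat) (v : 'cV[R]_n) : R :=
  Num.sqrt (\sum_i v i 0 ^+ 2).

Definition frobenius (R : realType) (p q : nat) (M : 'M[R]_(p, q)) : R :=
  Num.sqrt (\sum_i \sum_j M i j ^+ 2).

(* The real eigenvalues, each repeated according to its algebraic
   multiplicity; for a symmetric matrix these are all [n] eigenvalues. *)
Definition eigenvalues (R : realType) (n : nat) (M : 'M[R]_n) : seq R :=
  flatten [seq nseq (mup a (char_poly M)) a | a <- rootsR (char_poly M)].

(* One value per column of [M]: when [q > p] the surplus ones are zeros. *)
Definition singular_values (R : realType) (p q : nat) (M : 'M[R]_(p, q)) :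
    seq R :=
  [seq Num.sqrt a | a <- eigenvalues (M^T *m M)].

Definition nuclear_norm (R : realType) (p q : nat) (M : 'M[R]_(p, q)) : R :=
  \sum_(s <- singular_values M) s.

Definition borel_cV (R : realType) (n : nat) : set_system 'cV[R]_n :=
  <<s [set U : set 'cV[R]_n | open U] >>.

Definition random_vector d (Omega : measurableType d) (R : realType) (n : nat)
    (z : Omega -> 'cV[R]_n) : Prop :=
  forall B, borel_cV B -> measurable (z @^-1` B).

Definition mutually_independent d (Omega : measurableType d) (R : realType)
    (P : probability Omega R) (I : finType) (n : nat)
    (z : I -> Omega -> 'cV[R]_n) : Prop :=
  forall (J : {set I}) (B : I -> set 'cV[R]_n), (forall i, borel_cV (B i)) ->
  (P (\bigcap_(i in [set` J]) (z i @^-1` B i)) =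
   \prod_(i in J) P (z i @^-1` B i))%E.

(* The degenerate case is separate because [normal_prob m 0] is not the
   point mass at [m].  The second parameter of [normal_prob] is the standard
   deviation. *)
Definition normal_law (R : realType) (mean variance : R) (B : set R) : \bar R :=
  if variance == 0 then \d_mean B else normal_prob mean (Num.sqrt variance) B.

(* [z] ~ N(mu, Sigma), with singular [Sigma] allowed: every linear functional
   of [z] is normal. *)
Definition normal_vector d (Omega : measurableType d) (R : realType)
    (P : probability Omega R) (n : nat) (z : Omega -> 'cV[R]_n)
    (mu : 'cV[R]_n) (Sigma : 'M[R]_n) : Prop :=
  random_vector z /\
  forall (a : 'cV[R]_n) (B : set R), measurable B ->
    P ((fun o => (a^T *m z o) 0 0) @^-1` B) =
    normal_law ((a^T *m mu) 0 0) ((a^T *m Sigma *m a) 0 0) B.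

Definition mxexpectation d (Omega : measurableType d) (R : realType)
    (P : probability Omega R) (p q : nat) (Z : Omega -> 'M[R]_(p, q)) :
    'M[R]_(p, q) :=
  \matrix_(i, j) fine ('E_P[fun o => Z o i j])%E.

Definition mxvariance d (Omega : measurableType d) (R : realType)
    (P : probability Omega R) (n : nat) (z : Omega -> 'cV[R]_n) : 'M[R]_n :=
  let mu := mxexpectation P z in
  mxexpectation P (fun o => (z o - mu) *m (z o - mu)^T).

(* W^2(N(mu1, Sigma1), N(mu2, Sigma2)) *)
Definition wasserstein2 (R : realType) (n : nat) (mu1 : 'cV[R]_n)
    (Sigma1 : 'M[R]_n) (mu2 : 'cV[R]_n) (Sigma2 : 'M[R]_n) : R :=
  l2norm (mu1 - mu2) ^+ 2 +
  \tr (Sigma1 + Sigma2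
       - 2 *: mxsqrt (mxsqrt Sigma2 *m Sigma1 *m mxsqrt Sigma2)).

Definition optimal_value (R : realType) (X : Type) (F : set X) (f : X -> R) :
    \bar R :=
  ereal_inf [set (f x)%:E | x in F].

Definition minimizers (R : realType) (X : Type) (F : set X) (f : X -> R) :
    set X :=
  [set x | F x /\ forall y, F y -> f x <= f y].

(* Extension by zero, so that a family over 'I_T can be read at a natural
   number; it is only relevant at indices below T. *)
Definition ext0 (V : nmodType) (T : nat) (f : 'I_T -> V) (t : nat) : V :=
  oapp f 0 (insub t).

(* [gainK p t tau], for tau < t < T, is the gain K_(t-1,tau): the indices
   (t-1, tau) run exactly over the pairs 0 <= tau <= t-1 <= T-2. *)
Record policy (R : realType) (n m T : nat) := Policy {
  ff : 'I_T -> 'cV[R]_m ;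
  gainL : 'I_T -> 'M[R]_(m, n) ;
  gainK : forall t : 'I_T, 'I_t -> 'M[R]_(m, n) }.

Arguments gainK {R n m T} p t tau : rename.

(* Closed-loop input and state along one realization [x0], [w] of the initial
   state and of the noise. *)
Definition input (R : realType) (n m T : nat) (mu0 : 'cV[R]_n)
    (p : policy R n m T) (x0 : 'cV[R]_n) (w : 'I_T -> 'cV[R]_n) (t : 'I_T) :
    'cV[R]_m :=
  ff p t + gainL p t *m (x0 - mu0) +
  \sum_(tau < t) gainK p t tau *m w (widen_ord (ltnW (ltn_ord t)) tau).

Fixpoint state (R : realType) (n m T : nat) (A : 'I_T -> 'M[R]_n)
    (B : 'I_T -> 'M[R]_(n, m)) (mu0 : 'cV[R]_n) (p : policy R n m T)
    (x0 : 'cV[R]_n) (w : 'I_T -> 'cV[R]_n) (t : nat) : 'cV[R]_n :=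
  if t is s.+1 then
    ext0 A s *m state A B mu0 p x0 w s
    + ext0 B s *m ext0 (input mu0 p x0 w) s + ext0 w s
  else x0.

Definition terminal_state d (Omega : measurableType d) (R : realType)
    (n m T : nat) (A : 'I_T -> 'M[R]_n) (B : 'I_T -> 'M[R]_(n, m))
    (mu0 : 'cV[R]_n) (x0 : Omega -> 'cV[R]_n) (w : 'I_T -> Omega -> 'cV[R]_n)
    (p : policy R n m T) (o : Omega) : 'cV[R]_n :=
  state A B mu0 p (x0 o) (fun t => w t o) T.

Definition input_energy d (Omega : measurableType d) (R : realType)
    (n m T : nat) (mu0 : 'cV[R]_n) (x0 : Omega -> 'cV[R]_n)
    (w : 'I_T -> Omega -> 'cV[R]_n) (p : policy R n m T) (o : Omega) : R :=
  let u := input mu0 p (x0 o) (fun t => w t o) in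
  \sum_(t < T) ((u t)^T *m u t) 0 0.

Definition sccs_objective d (Omega : measurableType d) (R : realType)
    (P : probability Omega R) (n m T : nat) (A : 'I_T -> 'M[R]_n)
    (B : 'I_T -> 'M[R]_(n, m)) (mu0 : 'cV[R]_n) (x0 : Omega -> 'cV[R]_n)
    (w : 'I_T -> Omega -> 'cV[R]_n) (mud : 'cV[R]_n) (Sigmad : 'M[R]_n)
    (p : policy R n m T) : R :=
  let xT := terminal_state A B mu0 x0 w p in
  wasserstein2 (mxexpectation P xT) (mxvariance P xT) mud Sigmad.

Definition sccs_feasible d (Omega : measurableType d) (R : realType)
    (P : probability Omega R) (n m T : nat) (mu0 : 'cV[R]_n)
    (x0 : Omega -> 'cV[R]_n) (w : 'I_T -> Omega -> 'cV[R]_n) (rho : R) :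
    set (policy R n m T) :=
  [set p | ('E_P[input_energy mu0 x0 w p] - (rho ^+ 2)%:E <= 0)%E].

Notation bdim T n := (\sum_(i < T) n)%N (only parsing).

Record stacked (R : realType) (n m T : nat) := Stacked {
  st_u : 'cV[R]_(bdim T m) ;
  st_L : 'M[R]_(bdim T m, n) ;
  st_K : 'M[R]_(bdim T m, bdim T n) }.

Definition stack (R : realType) (n m T : nat) (p : policy R n m T) :
    stacked R n m T :=
  Stacked (\mxcol_(t < T) ff p t) (\mxcol_(t < T) gainL p t)
    (\mxblock_(i < T, j < T) ext0 (gainK p i) j).

Definition strictly_block_lower (R : realType) (n m T : nat)
    (K : 'M[R]_(bdim T m, bdim T n)) : Prop :=
  forall i j : 'I_T, (i <= j)%N ->
    @submxblock R T T (fun=> m) (fun=> n) K i j = 0.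

(* Phi(t, tau) = A(t-1) ... A(tau) for tau <= t. *)
Definition Phi (R : realType) (n T : nat) (A : 'I_T -> 'M[R]_n)
    (t tau : nat) : 'M[R]_n :=
  \big[mulmx/1%:M]_(s <- rev (index_iota tau t)) ext0 A s.

Definition Gu (R : realType) (n m T : nat) (A : 'I_T -> 'M[R]_n)
    (B : 'I_T -> 'M[R]_(n, m)) : 'M[R]_(bdim T.+1 n, bdim T m) :=
  \mxblock_(t < T.+1, tau < T)
    (if (tau < t)%N then Phi A t tau.+1 *m B tau else 0).

Definition Gw (R : realType) (n T : nat) (A : 'I_T -> 'M[R]_n) :
    'M[R]_(bdim T.+1 n, bdim T n) :=
  \mxblock_(t < T.+1, tau < T) (if (tau < t)%N then Phi A t tau.+1 else 0).

Definition G0 (R : realType) (n T : nat) (A : 'I_T -> 'M[R]_n) :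
    'M[R]_(bdim T.+1 n, n) :=
  \mxcol_(t < T.+1) Phi A t 0.

Definition bigW (R : realType) (n T : nat) (W : 'M[R]_n) :
    'M[R]_(bdim T n) :=
  \mxdiag_(t < T) W.

Definition Plast (R : realType) (n T : nat) : 'M[R]_(n, bdim T.+1 n) :=
  \mxrow_(t < T.+1) (if t == ord_max then 1%:M else 0).

Definition zeta (R : realType) (n m T q : nat) (A : 'I_T -> 'M[R]_n)
    (B : 'I_T -> 'M[R]_(n, m)) (Rm : 'M[R]_(n + bdim T n, q))
    (L : 'M[R]_(bdim T m, n)) (K : 'M[R]_(bdim T m, bdim T n)) :
    'M[R]_(n, q) :=
  Plast R n T *m row_mx (G0 A + Gu A B *m L) (Gw A + Gu A B *m K) *m Rm.

Definition nlp_objective (R : realType) (n m T q : nat) (A : 'I_T -> 'M[R]_n)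
    (B : 'I_T -> 'M[R]_(n, m)) (mu0 mud : 'cV[R]_n) (Sigmad : 'M[R]_n)
    (v : stacked R n m T * 'M[R]_(n, q)) : R :=
  let: (s, xi) := v in
  l2norm (Plast R n T *m (Gu A B *m st_u s + G0 A *m mu0) - mud) ^+ 2
  + frobenius xi ^+ 2 + \tr Sigmad - 2 * nuclear_norm (mxsqrt Sigmad *m xi).

Definition nlp_feasible (R : realType) (n m T q : nat) (A : 'I_T -> 'M[R]_n)
    (B : 'I_T -> 'M[R]_(n, m)) (Sigma0 W : 'M[R]_n)
    (Rm : 'M[R]_(n + bdim T n, q)) (rho : R) :
    set (stacked R n m T * 'M[R]_(n, q)) :=
  [set v | let: (s, xi) := v in
    [/\ strictly_block_lower (st_K s),
        xi = zeta A B Rm (st_L s) (st_K s) &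
        ((st_u s)^T *m st_u s) 0 0 + \tr (st_K s *m bigW T W *m (st_K s)^T)
        + \tr (st_L s *m Sigma0 *m (st_L s)^T) - rho ^+ 2 <= 0]].

Definition to_nlp (R : realType) (n m T q : nat) (A : 'I_T -> 'M[R]_n)
    (B : 'I_T -> 'M[R]_(n, m)) (Rm : 'M[R]_(n + bdim T n, q))
    (p : policy R n m T) : stacked R n m T * 'M[R]_(n, q) :=
  let s := stack p in (s, zeta A B Rm (st_L s) (st_K s)).

(* Main.v *)
(* The noise enters the closed loop linearly: stacking [x0 - mu0] and the [w t]
   into one centered vector [xi] with covariance [bdiag (Sigma0, W, ..., W) =
   Rm Rm^T], the terminal state is [c + M xi] and the stacked input is
   [u + [L K] xi].  Hence the terminal variance is [zeta zeta^T] with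
   [zeta = M Rm], and the expected energy is a sum of traces.  Finally, for
   [C = Sigmad^(1/2) zeta], the trace of [(C C^T)^(1/2)] is the nuclear norm of
   [C], because [C C^T] and [C^T C] have the same nonzero eigenvalues.  Only
   first and second moments matter: those of each block come from its one
   dimensional projections, and the cross moments vanish by independence. *)
Require Import Defs.
From HB Require Import structures.
From mathcomp Require Import all_boot all_order all_algebra.
From mathcomp Require Import polyrcf complex spectral ring lra.
From mathcomp Require Import all_classical all_reals all_analysis.
From mathcomp Require Import measurable_realfun.
Set Implicit Arguments.
Unset Strict Implicit.
Unset Printing Implicit Defensive.
Import Order.TTheory GRing.Theory Num.Theory.
Import numFieldNormedType.Exports.
Local Open Scope classical_set_scope.
Local Open Scope ring_scope.

(** Three objects are known only indirectly, and this shapes the argument. A positive semidefinite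
    root is a chosen matrix with a defining property, so its trace is recovered from its square: the
    eigenvalues of [S *m S] are the squares of the nonnegative eigenvalues of [S], hence its
    characteristic polynomial determines [\tr S]. The singular values of [C] come from [C^T *m C],
    whose size differs from that of [C *m C^T]; the two characteristic polynomials agree only up to
    powers of ['X], and the extra zeros are harmless because the square root of 0 is 0. A normal
    vector is known only through the laws of its linear functionals, so its covariances come by
    polarization from the variances along [e_i], [e_j] and [e_i + e_j]. In dimension one the
    variance reduces to the integral of [2 x^2 exp(-x^2)], while the mean comes from symmetry: the
    positive and negative parts of the centered variable have the same integral, which is finite
    because the second moment is. *)

(** * Diagonalization of real symmetric matrices and positive semidefinite roots *)

Lemma psdmx_gram (R : realType) (p q : nat) (C : 'M[R]_(p, q)) :
  psdmx (C *m C^T).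
Proof.
split=> [|v]; first by rewrite trmx_mul trmxK.
rewrite mulmxA -mulmxA -[v^T *m C]trmxK trmx_mul trmxK mxE.
by apply: sumr_ge0 => i _; rewrite [(_^T) 0 i]mxE -expr2 sqr_ge0.
Qed.

(* Over [R[i]] the spectral theorem applies and the eigenvalues are real;
   similarity of real matrices descends to [R]. *)
Lemma symmetric_diagonalizable (R : realType) (n : nat) (M : 'M[R]_n) :
  M^T = M ->
  exists P : 'M[R]_n, exists2 d : 'rV[R]_n,
    P \in unitmx & P *m M = diag_mx d *m P.
Proof.
move=> Msym; pose rc := real_complex R; pose M' := map_mx rc M.
have real_rc (p q : nat) (N : 'M[R]_(p, q)) :
    map_mx rc N \is a mxOver Num.real.
  apply/mxOverP => i j; rewrite mxE.
  by apply/complex_realP; exists (N i j).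
have Re_rc (p q : nat) (N : 'M[R[i]]_(p, q)) :
    N \is a mxOver Num.real -> N = map_mx rc (map_mx (@complex.Re R) N).
  move=> /mxOverP N_real; apply/matrixP => i j.
  by rewrite !mxE /rc RRe_real.
have Mherm : M' \is hermsymmx.
  apply: realsym_hermsym (real_rc _ _ _); apply/(is_hermitianmxP _ _ _).
  by rewrite expr0 scale1r map_mx_id// /M' map_trmx Msym.
have /hermitian_normalmx /orthomx_spectralP := Mherm.
move: (spectral_unit M') (hermitian_spectral_diag_real Mherm).
move: (spectralmx M') (spectral_diag M') => U D Uunit Dreal M'E.
have simM : exists2 P, P \in unitmx & similar P M' (diag_mx D).
  exists U => //; apply/(similarP Uunit).
  by rewrite M'E !mulmxA mulmxV// mul1mx.
have diag_real : diag_mx D \is a mxOver Num.real.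
  by rewrite mxOver_diag// rpred0.
have [P /andP[Preal Punit] PM] := real_similar simM (real_rc _ _ _) diag_real.
exists (map_mx (@complex.Re R) P), (map_mx (@complex.Re R) D).
  by rewrite -(map_unitmx rc) -Re_rc.
apply: (@map_mx_inj _ _ rc).
rewrite !map_mxM map_diag_mx -!Re_rc//.
exact/(similarP Punit).
Qed.

Section DiagonalizedSymmetric.
Variables (R : realType) (n : nat) (M P : 'M[R]_n) (d : 'rV[R]_n).
Hypotheses (Msym : M^T = M) (Punit : P \in unitmx).
Hypothesis PM : P *m M = diag_mx d *m P.

(** The functional calculus f(M), through a diagonalization in which [P] is merely invertible; the
    symmetry of f(M) is therefore not immediate. *)
Definition diag_fun (f : R -> R) : 'M[R]_n :=
  invmx P *m diag_mx (map_mx f d) *m P.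

Lemma diag_fun_id : diag_fun id = M.
Proof. by rewrite /diag_fun map_mx_id// -mulmxA -PM mulKmx. Qed.

Lemma diag_funM f g : diag_fun f *m diag_fun g = diag_fun (fun x => f x * g x).
Proof.
rewrite /diag_fun !mulmxA mulmxK// -[X in X *m P]mulmxA mulmx_diag.
by congr (_ *m diag_mx _ *m _); apply/rowP => i; rewrite !mxE.
Qed.

Lemma eq_diag_fun f g : (forall i, f (d 0 i) = g (d 0 i)) ->
  diag_fun f = diag_fun g.
Proof.
by move=> fg; congr (_ *m diag_mx _ *m _); apply/rowP => i; rewrite !mxE.
Qed.

(* [P P^T] commutes with the diagonal matrix of [d], hence with every diagonal
   matrix constant where [d] is. *)
Lemma diag_fun_sym f : (diag_fun f)^T = diag_fun f.
Proof.
have [G GE] : exists G, G = P *m P^T by exists (P *m P^T).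
have GdE : diag_mx d *m G = G *m diag_mx d.
  rewrite GE mulmxA -PM -mulmxA -{1}Msym -trmx_mul PM.
  by rewrite trmx_mul tr_diag_mx mulmxA.
have GfE : diag_mx (map_mx f d) *m G = G *m diag_mx (map_mx f d).
  apply/matrixP => i j; rewrite mul_diag_mx mul_mx_diag !mxE.
  have /matrixP/(_ i j) := GdE; rewrite mul_diag_mx mul_mx_diag !mxE => Gij.
  have [eq_d|neq_d] := eqVneq (d 0 i) (d 0 j); first by rewrite eq_d mulrC.
  suff -> : G i j = 0 by rewrite mulr0 mul0r.
  apply/eqP; have /eqP := Gij; rewrite (mulrC _ (d 0 j)) -subr_eq0 -mulrBl.
  by rewrite mulf_eq0 subr_eq0 (negbTE neq_d).
rewrite /diag_fun !trmx_mul tr_diag_mx trmx_inv.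
(* Multiplying by [P] on the left and by [P^T] on the right turns the symmetry of f(M) into the
   commutation [GfE]. *)
apply: (can_inj (mulKmx Punit)); apply: (can_inj (mulmxK (_ : P^T \in unitmx))).
  by rewrite unitmx_tr.
rewrite !mulmxA mulmxV// mul1mx mulmxKV ?unitmx_tr//.
by rewrite -[RHS]mulmxA -GE -GfE GE mulmxA.
Qed.

(** Row [i] of [P] is a left eigenvector for [d 0 i], nonzero since [P] is invertible; evaluating
    the quadratic form of [M] on it gives [d 0 i] times a positive number. *)
Lemma diag_eigenvalue_ge0 : psdmx M -> forall i, 0 <= d 0 i.
Proof.
move=> [_ Mpsd] i; pose r := row i P.
have rM : r *m M = d 0 i *: r.
  by rewrite -row_mul PM mul_diag_mx; apply/rowP => j; rewrite !mxE.
have r_neq0 : r != 0.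
  apply: contraTneq Punit => r0; rewrite -row_free_unit -kermx_eq0.
  apply/rowV0Pn; exists (delta_mx 0 i).
    by apply/sub_kermxP; rewrite -rowE.
  apply/eqP => /matrixP /(_ 0 i); rewrite !mxE !eqxx /= => /eqP.
  by rewrite oner_eq0.
have := Mpsd r^T; rewrite trmxK rM -scalemxAl mxE.
rewrite pmulr_lge0//.
rewrite lt_neqAle; apply/andP; split; last first.
  by rewrite mxE sumr_ge0// => k _; rewrite [r^T _ _]mxE -expr2 sqr_ge0.
apply: contra r_neq0; rewrite mxE eq_sym psumr_eq0; last first.
  by move=> k _; rewrite [r^T _ _]mxE -expr2 sqr_ge0.
move=> /allP r0; apply/eqP/rowP => k.
have := r0 k (mem_index_enum _); rewrite /= [r^T _ _]mxE -expr2 sqrf_eq0.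
by rewrite [RHS]mxE => /eqP.
Qed.

Lemma char_poly_diag_fun f :
  char_poly (diag_fun f) = \prod_(i < n) ('X - (f (d 0 i))%:P).
Proof.
rewrite /char_poly.
have -> : char_poly_mx (diag_fun f) =
    map_mx polyC (invmx P) *m char_poly_mx (diag_mx (map_mx f d)) *m
    map_mx polyC P.
  rewrite /char_poly_mx mulmxBr mulmxBl -!map_mxM mul_mx_scalar -scalemxAl.
  by rewrite -map_mxM mulVmx// map_mx1 scalemx1.
rewrite !det_mulmx mulrAC -det_mulmx -map_mxM mulVmx// map_mx1 det1 mul1r.
rewrite -/(char_poly _) char_poly_trig ?diag_mx_is_trig//.
by apply: eq_bigr => i _; rewrite !mxE eqxx mulr1n.
Qed.

Lemma mxtrace_diag_fun f : \tr (diag_fun f) = \sum_i f (d 0 i).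
Proof.
rewrite /diag_fun -mulmxA mxtrace_mulC mulmxK// mxtrace_diag.
by apply: eq_bigr => i _; rewrite mxE.
Qed.

End DiagonalizedSymmetric.

Lemma psdmx_sqrt_exists (R : realType) (n : nat) (M : 'M[R]_n) : psdmx M ->
  exists S, psdmx S /\ S *m S = M.
Proof.
move=> Mpsd; have Msym := Mpsd.1.
have [P [d Punit PM]] := symmetric_diagonalizable Msym.
have d_ge0 := diag_eigenvalue_ge0 Punit PM Mpsd.
(* The fourth root of [M]: it exhibits the square root as the Gram matrix [F *m F^T], hence as
   positive semidefinite. *)
pose F := diag_fun P d (fun x => Num.sqrt (Num.sqrt x)).
exists (diag_fun P d Num.sqrt); split; last first.
  rewrite diag_funM// -[RHS](diag_fun_id Punit PM).
  by apply: eq_diag_fun => i; rewrite -expr2 sqr_sqrtr.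
have -> : diag_fun P d Num.sqrt = F *m F^T.
  rewrite (diag_fun_sym Msym Punit PM) diag_funM//.
  by apply: eq_diag_fun => i; rewrite -expr2 sqr_sqrtr// sqrtr_ge0.
exact: psdmx_gram.
Qed.

(** If [M] has no positive semidefinite root, [mxsqrt M] is the default 0, which is symmetric as
    well. *)
Lemma mxsqrt_sym (R : realType) (n : nat) (M : 'M[R]_n) :
  (mxsqrt M)^T = mxsqrt M.
Proof. by rewrite /mxsqrt; case: xgetP => [S _ [[]]//|_]; rewrite trmx0. Qed.

Lemma mxsqrtP (R : realType) (n : nat) (M : 'M[R]_n) : psdmx M ->
  psdmx (mxsqrt M) /\ mxsqrt M *m mxsqrt M = M.
Proof. by move=> /psdmx_sqrt_exists; exact: xgetPex. Qed.

(** * Characteristic polynomials, the nuclear norm and the Wasserstein objective *)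

(** In both sequences a value occurs as often as its multiplicity as a root of the characteristic
    polynomial. *)
Lemma perm_eigenvalues (R : realType) (n : nat) (M : 'M[R]_n) (s : seq R) :
  char_poly M = \prod_(x <- s) ('X - x%:P) -> perm_eq (eigenvalues M) s.
Proof.
move=> Ms; apply/allP => a _; apply/eqP => /=.
have M_neq0 : char_poly M != 0 by rewrite monic_neq0// char_poly_monic.
have count_nseq_if (b : R) k : count_mem a (nseq k b) = ((b == a) * k)%N.
  exact: count_nseq.
rewrite /eigenvalues count_flatten -!map_comp sumnE big_map.
under eq_bigr => b _ do rewrite /= count_nseq_if.
rewrite -(mu_prod_XsubC a s) -Ms.
have roots_uniq : uniq (rootsR (char_poly M)) by exact: uniq_roots.
have mem_roots := roots_on_rootsR M_neq0.
have [a_root|a_Nroot] := boolP (a \in rootsR (char_poly M)).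
  rewrite (bigD1_seq a)//= eqxx mul1n big1 ?addn0//.
  by move=> b /negbTE ->; rewrite mul0n.
rewrite big1_seq => [|b /= b_root].
  rewrite mupNroot//; have := mem_roots a.
  by rewrite in_itv/= (negbTE a_Nroot) => ->.
by rewrite (_ : (b == a) = false)//; apply: contraNF a_Nroot => /eqP <-.
Qed.

(** Sylvester's identity. The block matrix [B] becomes block triangular after either of two left
    multiplications, one clearing the block [D], the other the block [C]; comparing determinants
    gives the two sides. *)
Lemma char_poly_mulmxC (R : comNzRingType) (p q : nat) (C : 'M[R]_(p, q))
    (D : 'M[R]_(q, p)) :
  'X^q * char_poly (C *m D) = 'X^p * char_poly (D *m C).
Proof.
pose C' := map_mx polyC C; pose D' := map_mx polyC D.
pose B := block_mx ('X%:M) C' D' (1%:M).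
have <- : \det (block_mx 1%:M 0 (- D') 'X%:M *m B) = 'X^p * char_poly (D *m C).
  rewrite /B mulmx_block !mul1mx !mul0mx !addr0 mulmx1.
  have -> : - D' *m 'X%:M + 'X%:M *m D' = 0.
    by rewrite -scalar_mxC mulNmx addNr.
  rewrite mulNmx -map_mxM addrC det_ublock det_scalar.
  by rewrite /char_poly /char_poly_mx.
have -> : 'X^q * char_poly (C *m D) =
    \det (block_mx 1%:M 0 (- D') 'X%:M) *
    \det (block_mx 1%:M (- C') 0 1%:M *m B).
  rewrite det_lblock det1 mul1r det_scalar; congr (_ * _).
  rewrite /B mulmx_block !mul1mx !mul0mx !add0r mulmx1 addrN.
  by rewrite det_lblock det1 mulr1 mulNmx -map_mxM.
by rewrite !det_mulmx det_ublock !det1 !mul1r.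
Qed.

(** The list [s] consists of the squared eigenvalues of [S]; these eigenvalues are nonnegative, so
    square roots give them back. *)
Lemma mxtrace_sqrt (R : realType) (n : nat) (S : 'M[R]_n) : psdmx S ->
  exists s : seq R, char_poly (S *m S) = \prod_(x <- s) ('X - x%:P) /\
    \tr S = \sum_(x <- s) Num.sqrt x.
Proof.
move=> Spsd; have Ssym := Spsd.1.
have [P [d Punit PS]] := symmetric_diagonalizable Ssym.
have d_ge0 := diag_eigenvalue_ge0 Punit PS Spsd.
exists [seq d 0 i * d 0 i | i <- index_enum 'I_n]; rewrite !big_map.
rewrite -[in S *m S](diag_fun_id Punit PS) diag_funM// char_poly_diag_fun//.
split=> //; rewrite -[in LHS](diag_fun_id Punit PS) mxtrace_diag_fun//.
by apply: eq_bigr => i _; rewrite -expr2 sqrtr_sqr ger0_norm.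
Qed.

Lemma mxtrace_mxsqrt_gram (R : realType) (p q : nat) (C : 'M[R]_(p, q)) :
  \tr (mxsqrt (C *m C^T)) = nuclear_norm C.
Proof.
have [S_psd SS] := mxsqrtP (psdmx_gram C).
have [s [CCs ->]] := mxtrace_sqrt S_psd; rewrite SS in CCs.
have CTC_psd : psdmx (C^T *m C) by rewrite -{2}[C]trmxK; exact: psdmx_gram.
(* This root serves to split the characteristic polynomial of [C^T *m C] into real linear
   factors. *)
have [S'_psd SS'] := mxsqrtP CTC_psd.
have [t [CCt _]] := mxtrace_sqrt S'_psd; rewrite SS' in CCt.
rewrite /nuclear_norm /singular_values big_map.
rewrite (perm_big _ (perm_eigenvalues CCt)).
have prod_zeros k (u : seq R) :
    'X^k * \prod_(x <- u) ('X - x%:P) = \prod_(x <- nseq k 0 ++ u) ('X - x%:P).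
  rewrite big_cat /=; congr (_ * _); rewrite big_nseq polyC0 subr0.
  by rewrite -Monoid.iteropE.
have sum_zeros k (u : seq R) :
    \sum_(x <- u) Num.sqrt x = \sum_(x <- nseq k 0 ++ u) Num.sqrt x.
  by rewrite big_cat /= big_nseq sqrtr0 iter_addr_0 mul0rn add0r.
(* Padding [s] with q zeros and [t] with p zeros gives lists with the same product of linear
   factors, hence permutations of each other. *)
rewrite (sum_zeros q) (sum_zeros p t); apply/perm_big/prod_XsubC_eq.
by rewrite -!prod_zeros -CCs -CCt char_poly_mulmxC.
Qed.

Lemma frobenius_sqr (R : realType) (p q : nat) (C : 'M[R]_(p, q)) :
  frobenius C ^+ 2 = \tr (C *m C^T).
Proof.
rewrite /frobenius sqr_sqrtr; last first.
  by apply: sumr_ge0 => i _; apply: sumr_ge0 => j _; rewrite sqr_ge0.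
apply: eq_bigr => i _; rewrite mxE.
by apply: eq_bigr => j _; rewrite mxE -expr2.
Qed.

(** Since [mxsqrt Sigmad] is symmetric, the matrix under the outer root is the Gram matrix of
    [mxsqrt Sigmad *m C]. *)
Lemma wasserstein2_gram (R : realType) (n q : nat) (mu mud : 'cV[R]_n)
    (Sigmad : 'M[R]_n) (C : 'M[R]_(n, q)) :
  wasserstein2 mu (C *m C^T) mud Sigmad =
  l2norm (mu - mud) ^+ 2 + frobenius C ^+ 2 + \tr Sigmad
  - 2 * nuclear_norm (mxsqrt Sigmad *m C).
Proof.
rewrite /wasserstein2 -mxtrace_mxsqrt_gram frobenius_sqr.
rewrite mxtraceD raddfN /= mxtraceZ mxtraceD trmx_mul mxsqrt_sym !mulmxA.
by rewrite !addrA.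
Qed.

(** * Moments of the one-dimensional normal law *)

Import gauss_integral_proof.

Section NormalMoments.
Variable R : realType.
Let mu := @lebesgue_measure R.

(** Squeezed below 1/x, because [x^2 <= 1 + x^2 <= exp(x^2)]. *)
Let cvg_mul_gauss : x * gauss_fun x @[x --> +oo] --> (0 : R).
Proof.
apply: (@squeeze_cvgr _ _ _ _ (cst 0) (fun x => x^-1)).
- near=> x.
  have x_gt0 : 0 < x by near: x; exact: nbhs_pinfty_gt.
  rewrite mulr_ge0 ?gauss_fun_ge0 ?(ltW x_gt0)//= -[x^-1]mul1r ler_pdivlMr//.
  rewrite mulrAC -expr2 /gauss_fun expRN.
  rewrite ler_pdivrMr ?expR_gt0// mul1r.
  by apply: le_trans (expR_ge1Dx _); rewrite lerDr.
- exact: cvg_cst.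
- by apply/gtr0_cvgV0; [exact: nbhs_pinfty_gt|exact: cvg_id].
Unshelve. all: end_near. Qed.

Let cvg_integral0_gauss : @integral0_gauss R x @[x --> +oo] --> Num.sqrt pi / 2.
Proof.
have -> : Num.sqrt pi / 2 = Num.sqrt (pi / 4) :> R.
  have -> : 4 = 2 ^+ 2 :> R by rewrite -natrX.
  by rewrite sqrtrM ?pi_ge0// sqrtrV// sqrtr_sqr normr_nat.
have -> : @integral0_gauss R = fun x => Num.sqrt (integral0_gauss x ^+ 2).
  by apply/funext => x; rewrite sqrtr_sqr ger0_norm ?integral0_gauss_ge0.
exact: cvg_comp cvg_integral0_gauss_sqr (@sqrt_continuous R _).
Qed.

Let continuous_sqr_gauss : continuous (fun x : R => 2 * x ^+ 2 * gauss_fun x).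
Proof.
move=> x; apply: cvgM; last exact: continuous_gauss_fun.
by apply: cvgM; [exact: cvg_cst|exact: exprn_continuous].
Qed.

(* [2 x^2 exp(-x^2)] is the derivative of
   [int_0^x exp(-t^2) dt - x exp(-x^2)]. *)
Let integral0y_sqr_gauss :
  (\int[mu]_(x in `[0%R, +oo[) (2 * x ^+ 2 * gauss_fun x)%:E =
   (Num.sqrt pi / 2)%:E)%E.
Proof.
pose F (x : R) := @integral0_gauss R x - x * gauss_fun x.
have F0 : F 0 = 0.
  by rewrite /F /integral0_gauss set_itv1 Rintegral_set1 mul0r subr0.
have int_gauss (x : R) : mu.-integrable `[0, x] (EFin \o gauss_fun).
  apply: continuous_compact_integrable; first exact: segment_compact.
  by apply: continuous_subspaceT; exact: continuous_gauss_fun.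
have is_derive_mul (x : R) : is_derive x 1 (fun x : R => x * gauss_fun x)
    (gauss_fun x - 2 * x ^+ 2 * gauss_fun x).
  rewrite /gauss_fun.
  apply: is_derive_eq.
  by rewrite /GRing.scale /=; ring.
have is_derive_F (x : R) : 0 < x -> is_derive x 1 F (2 * x ^+ 2 * gauss_fun x).
  move=> x_gt0.
  (* The endpoint [x + 1] is an arbitrary bound that makes [x] interior. *)
  have [dI I'E] := @continuous_FTC1_closed R gauss_fun 0 x (x + 1)
     (ltr_pwDr ltr01 (lexx x)) (int_gauss (x + 1)) x_gt0
     (@continuous_gauss_fun R x).
  have I' : is_derive x 1 (@integral0_gauss R) (gauss_fun x).
    by apply: DeriveDef; [exact: dI|rewrite -derive1E].
  by apply: is_derive_eq; rewrite opprB addrC subrK.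
rewrite (@ge0_continuous_FTC2y _ _ F _ (Num.sqrt pi / 2)).
- by rewrite F0 sube0.
- by move=> x _; rewrite mulr_ge0 ?gauss_fun_ge0// mulr_ge0// sqr_ge0.
- exact: (continuous_subspaceT continuous_sqr_gauss).
- by rewrite -[X in _ --> X]subr0; apply: cvgB.
- by move=> x /is_derive_F[].
- rewrite F0 -[X in _ --> X]subr0 /F.
  (* The derivative of [F] was found only at positive points, so the right limit at 0 needs the
     continuity of the integral in its upper endpoint. *)
  have : {within `[0, 1], continuous (@integral0_gauss R)}.
    by apply: parameterized_integral_continuous => //; exact: ler01.
  move=> /(continuous_within_itvP _ ltr01)[_ + _].
  rewrite {2}/integral0_gauss set_itv1 Rintegral_set1 => cI.
  have : x * gauss_fun x @[x --> (0 : R)^'+] --> 0 * gauss_fun (0 : R).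
    apply/cvg_at_right_filter.
    by apply: cvgM; [exact: cvg_id|exact: continuous_gauss_fun].
  by rewrite mul0r; exact: cvgB.
- move=> x; rewrite in_itv/= andbT => x_gt0.
  by rewrite derive1E; have [_ ->] := is_derive_F _ x_gt0.
Qed.

Let integralT_sqr_gauss :
  (\int[mu]_x (2 * x ^+ 2 * gauss_fun x)%:E = (Num.sqrt pi)%:E)%E.
Proof.
rewrite ge0_symfun_integralT//.
- rewrite (_ : [set x | _] = `[0, +oo[%classic); last first.
    by apply/seteqP; split => x/=; rewrite in_itv/= andbT.
  by rewrite integral0y_sqr_gauss -EFinM mulrCA divff// mulr1.
- by move=> x; rewrite mulr_ge0 ?gauss_fun_ge0// mulr_ge0// sqr_ge0.
- by move=> x/=; rewrite /gauss_fun sqrrN.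
Qed.

Let integral_oppr (f : R -> R) : measurable_fun setT f ->
  (forall x, 0 <= f x) ->
  (\int[mu]_x (f (- x))%:E = \int[mu]_x (f x)%:E)%E.
Proof.
move=> mf f0.
transitivity (\int[pushforward mu (-%R : R -> measurableTypeR R)]_x (f x)%:E)%E.
  rewrite ge0_integral_pushforward//=; first exact/measurable_EFinP.
  by move=> x _; rewrite lee_fin.
apply/esym; apply: eq_measure_integral => //= A mA _.
exact/esym/lebesgue_measureN.
Qed.

(* The change of variables [y = (x - m) / (s sqrt 2)]. *)
Let integral_normal_pdf_gauss (m s : R) (G : R -> R) : 0 < s ->
  continuous G -> (forall x, 0 <= G x) ->
  (\int[mu]_x ((G ((x - m) / (s * Num.sqrt 2)))%:E * (normal_pdf m s x)%:E) =
   (Num.sqrt pi)^-1%:E * \int[mu]_x (G x * gauss_fun x)%:E)%E.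
Proof.
move=> s_gt0 cG G_ge0.
have r2_gt0 : 0 < Num.sqrt 2 :> R by rewrite sqrtr_gt0.
have c_gt0 : 0 < s * Num.sqrt 2 by rewrite mulr_gt0.
pose F (x : R) := (x - m) / (s * Num.sqrt 2).
have dF (x : R) : is_derive x 1 F (s * Num.sqrt 2)^-1.
  by apply: is_derive_eq; rewrite /GRing.scale /=; ring.
have F'E : (F^`())%classic = cst (s * Num.sqrt 2)^-1.
  by apply/funext => x; rewrite derive1E; have [_ ->] := dF x.
have cGg : continuous (fun x => G x * gauss_fun x).
  by move=> x; apply: cvgM; [exact: cG|exact: continuous_gauss_fun].
rewrite (@increasing_ge0_integration_by_substitutionT _ F
  (fun x => G x * gauss_fun x)); first last.
- by move=> x; rewrite mulr_ge0 ?gauss_fun_ge0 ?G_ge0.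
- exact: cGg.
- apply: gt0_cvgMly; [by rewrite invr_gt0|exact: cvg_addrr].
- apply: gt0_cvgMlNy; [by rewrite invr_gt0|exact: cvg_addrr_Ny].
- by move=> x; have [] := dF x.
- by rewrite F'E; exact: is_cvg_cst.
- by rewrite F'E; exact: is_cvg_cst.
- by rewrite F'E => x; exact: cvg_cst.
- by move=> x y xy; rewrite /F ltr_pM2r ?invr_gt0// ltrD2r.
have mF : measurable_fun setT F.
  apply: continuous_measurable_fun => x.
  by apply/differentiable_continuous/derivable1_diffP; have [] := dF x.
rewrite F'E -ge0_integralZl//=; first last.
- move=> x _; rewrite lee_fin mulr_ge0 ?invr_ge0 ?(ltW c_gt0)//.
  by rewrite mulr_ge0 ?gauss_fun_ge0 ?G_ge0.
- apply/measurable_EFinP/measurable_funM => //.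
  exact: measurableT_comp (continuous_measurable_fun cGg) mF.
apply: eq_integral => x _; rewrite -!EFinM; congr (_%:E).
rewrite /normal_pdf (gt_eqF s_gt0) /normal_peak /normal_fun.
rewrite /gauss_fun !fctE /=.
have -> : - (x - m) ^+ 2 / (s ^+ 2 *+ 2) = - F x ^+ 2.
  rewrite mulNr /F exprMn exprVn exprMn sqr_sqrtr// -mulr_natr.
  by [].
(* The peak of the density is the derivative [(s * Num.sqrt 2)^-1] of [F] times [(Num.sqrt pi)^-1],
   the constant left outside the integral. *)
have -> : Num.sqrt (s ^+ 2 * pi *+ 2) = s * Num.sqrt pi * Num.sqrt 2.
  rewrite -[_ *+ 2]mulr_natr sqrtrM ?mulr_ge0 ?(ltW s_gt0) ?pi_ge0//.
  by rewrite sqrtrM ?sqr_ge0// sqrtr_sqr gtr0_norm.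
by rewrite /F !invfM; ring.
Qed.

(** Change of variables is available for the Radon-Nikodym derivative; it equals [normal_pdf] almost
    everywhere, as both have the same integral over every measurable set. *)
Lemma normal_probE (m s : R) (f : R -> R) : measurable_fun setT f ->
  (forall x, 0 <= f x) ->
  (\int[normal_prob m s]_x (f x)%:E =
   \int[mu]_x ((f x)%:E * (normal_pdf m s x)%:E))%E.
Proof.
move=> mf f_ge0; have dom := @normal_prob_dominates R m s.
rewrite -(Radon_Nikodym_SigmaFinite.change_of_variables dom)//; last first.
  exact/measurable_EFinP.
have m_pdf := @measurable_normal_pdf R m s.
apply: ae_eq_integral => //.
- apply: emeasurable_funM; first exact/measurable_EFinP.
  exact: measurable_int (Radon_Nikodym_SigmaFinite.f_integrable dom).
- by apply: emeasurable_funM; exact/measurable_EFinP.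
- apply: ae_eqe_mul2l; apply: integral_ae_eq => //.
  + exact: Radon_Nikodym_SigmaFinite.f_integrable.
  + exact/measurable_EFinP.
  + by move=> E _ mE; rewrite -(Radon_Nikodym_SigmaFinite.f_integral dom).
Qed.

Lemma integral_normal_sqr (m s : R) : 0 < s ->
  (\int[normal_prob m s]_x ((x - m) ^+ 2)%:E = (s ^+ 2)%:E)%E.
Proof.
move=> s_gt0.
have r2_gt0 : 0 < Num.sqrt 2 :> R by rewrite sqrtr_gt0.
have spi_gt0 : 0 < Num.sqrt pi :> R by rewrite sqrtr_gt0 pi_gt0.
rewrite normal_probE; last 2 first.
- by apply/measurable_funX/measurable_funB.
- by move=> x; rewrite sqr_ge0.
(* With [y = (x - m) / (s * Num.sqrt 2)], one has [(x - m)^2 = 2 s^2 y^2]. *)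
pose G (x : R) := s ^+ 2 * (2 * x ^+ 2).
transitivity (\int[mu]_x ((G ((x - m) / (s * Num.sqrt 2)))%:E *
    (normal_pdf m s x)%:E))%E.
  apply: eq_integral => x _; congr (_%:E * _)%E.
  rewrite /G exprMn exprVn exprMn sqr_sqrtr//.
  by field; rewrite gt_eqF.
rewrite integral_normal_pdf_gauss//; last 2 first.
- move=> x; apply: cvgM; first exact: cvg_cst.
  by apply: cvgM; [exact: cvg_cst|exact: exprn_continuous].
- by move=> x; rewrite /G mulr_ge0 ?sqr_ge0// mulr_ge0 ?sqr_ge0.
under eq_integral do rewrite /G -mulrA EFinM.
rewrite ge0_integralZl//=; last 3 first.
- apply/measurable_EFinP.
  exact: (continuous_measurable_fun continuous_sqr_gauss).
- by move=> x _; rewrite lee_fin mulr_ge0 ?gauss_fun_ge0// mulr_ge0// sqr_ge0.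
- by rewrite lee_fin sqr_ge0.
rewrite integralT_sqr_gauss -!EFinM; congr (_%:E).
by field; rewrite gt_eqF.
Qed.

(** The density is symmetric about [m]: after the change of variables the two integrals differ by
    the reflection [y -> - y]. *)
Lemma integral_normal_pos_neg (m s : R) : 0 < s ->
  (\int[normal_prob m s]_x (Num.max (x - m) 0)%:E =
   \int[normal_prob m s]_x (Num.max (m - x) 0)%:E)%E.
Proof.
move=> s_gt0.
have r2_gt0 : 0 < Num.sqrt 2 :> R by rewrite sqrtr_gt0.
have c_gt0 : 0 < s * Num.sqrt 2 by rewrite mulr_gt0.
pose G (x : R) := s * Num.sqrt 2 * Num.max x 0.
have cG : continuous G.
  move=> x; apply: cvgM; first exact: cvg_cst.
  by apply: continuous_max; [exact: cvg_id|exact: cvg_cst].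
have G_ge0 x : 0 <= G x by rewrite mulr_ge0 ?(ltW c_gt0)// le_max lexx orbT.
have max_ge0 (x : R) : 0 <= Num.max x 0 by rewrite le_max lexx orbT.
rewrite !normal_probE//; last 2 first.
- by apply: measurable_maxr => //; exact: measurable_funB.
- by apply: measurable_maxr => //; exact: measurable_funB.
have GE (x : R) : Num.max x 0 = G (x / (s * Num.sqrt 2)).
  rewrite /G maxr_pMr ?(ltW c_gt0)// mulr0 mulrC divfK ?gt_eqF//.
transitivity (\int[mu]_x ((G ((x - m) / (s * Num.sqrt 2)))%:E *
    (normal_pdf m s x)%:E))%E.
  by apply: eq_integral => x _; rewrite GE.
transitivity (\int[mu]_x (((G \o -%R) ((x - m) / (s * Num.sqrt 2)))%:E *
    (normal_pdf m s x)%:E))%E; last first.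
  by apply: eq_integral => x _; rewrite GE /= -mulNr opprB.
have cGN : continuous (G \o -%R).
  by move=> x; apply: continuous_comp; [exact: opp_continuous|exact: cG].
rewrite !integral_normal_pdf_gauss//; last by move=> x; exact: G_ge0.
congr (_ * _)%E; rewrite -integral_oppr.
- by apply: eq_integral => x _; rewrite /= /gauss_fun sqrrN.
- apply: measurable_funM; first exact: continuous_measurable_fun.
  exact: measurable_gauss_fun.
- by move=> x; rewrite mulr_ge0 ?gauss_fun_ge0.
Qed.

End NormalMoments.

(** * Square-integrable variables, normal variables and products of independent ones *)

Section SecondMoments.
Context d (Omega : measurableType d) (R : realType) (P : probability Omega R).
Implicit Types X Y : Omega -> R.

Definition square_integrable X :=
  measurable_fun setT X /\ P.-integrable setT (EFin \o (fun o => X o ^+ 2)).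

(** The product is dominated by [X^2 + Y^2]. *)
Lemma square_integrableM X Y : square_integrable X -> square_integrable Y ->
  P.-integrable setT (EFin \o (fun o => X o * Y o)).
Proof.
move=> [mX iX] [mY iY].
apply: le_integrable (integrableD measurableT iX iY) => //.
  by apply/measurable_EFinP; exact: measurable_funM.
move=> o _; rewrite /= lee_fin.
rewrite (ger0_norm (_ : 0 <= X o ^+ 2 + Y o ^+ 2)) ?addr_ge0 ?sqr_ge0//.
by case: (ler0P (X o * Y o)) => _; nra.
Qed.

Lemma square_integrable_integrable X : square_integrable X ->
  P.-integrable setT (EFin \o X).
Proof.
move=> sX; have s1 : square_integrable (cst 1).
  split; first exact: measurable_cst.
  by rewrite /= expr1n; exact: finite_measure_integrable_cst.
have := square_integrableM sX s1.
by under [X in EFin \o X]funext do rewrite mulr1.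
Qed.

Lemma ge0_integral_comp_law (nu : {measure set (measurableTypeR R) -> \bar R})
    X (f : R -> R) :
  measurable_fun setT X ->
  (forall B, measurable B -> P (X @^-1` B) = nu B) ->
  measurable_fun setT f -> (forall x, 0 <= f x) ->
  (\int[P]_o (f (X o))%:E = \int[nu]_x (f x)%:E)%E.
Proof.
move=> mX PXE mf f_ge0.
have mX' : measurable_fun setT (X : Omega -> measurableTypeR R) := mX.
pose X' : {mfun Omega >-> measurableTypeR R} :=
  HB.pack (X : Omega -> measurableTypeR R)
    (isMeasurableFun.Build _ _ _ _ _ mX').
transitivity (\int[pushforward P X']_x (f x)%:E)%E; last first.
  by apply: eq_measure_integral => A mA _; exact: PXE.
rewrite ge0_integral_pushforward//=; first exact/measurable_EFinP.
by move=> x _; rewrite lee_fin.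
Qed.

Section NormalVariable.
Variables (m v : R) (X : Omega -> R).
Hypotheses (v_ge0 : 0 <= v) (mX : measurable_fun setT X).
Hypothesis X_law : forall B, measurable B -> P (X @^-1` B) = normal_law m v B.

Let Y o := X o - m.

Lemma normal_law_sqr : (\int[P]_o (Y o ^+ 2)%:E = v%:E)%E.
Proof.
have m_sqr : measurable_fun setT (fun x : R => (x - m) ^+ 2).
  by apply/measurable_funX/measurable_funB.
have sqr_sub_ge0 (x : R) : 0 <= (x - m) ^+ 2 by rewrite sqr_ge0.
rewrite /Y; have [v0|v_neq0] := eqVneq v 0.
  rewrite (@ge0_integral_comp_law (\d_(m : measurableTypeR R)) X
    (fun x => (x - m) ^+ 2))//.
    rewrite integral_dirac//; last exact/measurable_EFinP.
    by rewrite subrr expr0n v0 mule0.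
  by move=> B mB; rewrite X_law// /normal_law v0 eqxx.
rewrite (@ge0_integral_comp_law (normal_prob m (Num.sqrt v)) X
  (fun x => (x - m) ^+ 2))//.
  rewrite integral_normal_sqr ?sqr_sqrtr//.
  by rewrite sqrtr_gt0 lt_neqAle eq_sym v_neq0.
by move=> B mB; rewrite X_law// /normal_law (negbTE v_neq0).
Qed.

Lemma normal_law_square_integrable : square_integrable Y.
Proof.
have mY : measurable_fun setT Y by exact: measurable_funB.
split=> //; apply/integrableP; split.
  by apply/measurable_EFinP/measurable_funX.
under eq_integral do rewrite /= ger0_norm ?sqr_ge0//.
by rewrite normal_law_sqr ltry.
Qed.

(** The integral is that of the positive part minus that of the negative part. They agree by
    symmetry, and their finiteness, inherited from square integrability, makes the difference 0. *)
Lemma normal_law_centered : (\int[P]_o (Y o)%:E = 0)%E.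
Proof.
have iY := square_integrable_integrable normal_law_square_integrable.
have mpos (c : R) : measurable_fun setT (fun x : R => Num.max (x - c) 0).
  by apply: measurable_maxr => //; exact: measurable_funB.
have mneg (c : R) : measurable_fun setT (fun x : R => Num.max (c - x) 0).
  by apply: measurable_maxr => //; exact: measurable_funB.
have max_ge0 (x : R) : 0 <= Num.max x 0 by rewrite le_max lexx orbT.
have pos_neg : (\int[P]_o (Num.max (X o - m) 0)%:E =
    \int[P]_o (Num.max (m - X o) 0)%:E)%E.
  have law_ext (nu : {measure set (measurableTypeR R) -> \bar R}) f :=
    @ge0_integral_comp_law nu X f mX.
  have [v0|v_neq0] := eqVneq v 0.
    have X_dirac C : measurable C ->
        P (X @^-1` C) = \d_(m : measurableTypeR R) C.
      by move=> mC; rewrite X_law// /normal_law v0 eqxx.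
    rewrite (law_ext _ (fun x => Num.max (x - m) 0) X_dirac)//.
    rewrite (law_ext _ (fun x => Num.max (m - x) 0) X_dirac)//.
    rewrite !integral_dirac//; apply/measurable_EFinP.
    - exact: (mneg m).
    - exact: (mpos m).
  have X_normal C : measurable C ->
      P (X @^-1` C) = normal_prob m (Num.sqrt v) C.
    by move=> mC; rewrite X_law// /normal_law (negbTE v_neq0).
  rewrite (law_ext _ (fun x => Num.max (x - m) 0) X_normal)//.
  rewrite (law_ext _ (fun x => Num.max (m - x) 0) X_normal)//.
  by rewrite integral_normal_pos_neg// sqrtr_gt0 lt_neqAle eq_sym v_neq0.
rewrite integralE.
have -> : (\int[P]_o ((fun o => (Y o)%:E)^\+ o) =
    \int[P]_o (Num.max (X o - m) 0)%:E)%E.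
  by apply: eq_integral => o _; rewrite funeposE -EFin_max.
have -> : (\int[P]_o ((fun o => (Y o)%:E)^\- o) =
    \int[P]_o (Num.max (X o - m) 0)%:E)%E.
  rewrite pos_neg; apply: eq_integral => o _.
  by rewrite funenegE -EFinN -EFin_max opprB.
rewrite subee//; apply: integrable_fin_num => //.
apply: le_integrable iY => //.
  by apply/measurable_EFinP; exact: measurableT_comp (mpos m) mX.
move=> o _; rewrite /= lee_fin ger0_norm// /Y ge_max normr_ge0 andbT.
exact: ler_norm.
Qed.

End NormalVariable.

(** Independence says that the joint law agrees with the product of the marginal laws on rectangles,
    hence everywhere; Fubini then factors the integral of the product of coordinates. *)
Lemma integral_independent_product X Y :
  square_integrable X -> square_integrable Y ->
  (forall A B, measurable A -> measurable B ->
     P (X @^-1` A `&` Y @^-1` B) = P (X @^-1` A) * P (Y @^-1` B))%E ->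
  (\int[P]_o (X o * Y o)%:E = \int[P]_o (X o)%:E * \int[P]_o (Y o)%:E)%E.
Proof.
move=> sX sY indep; have [mX _] := sX; have [mY _] := sY.
have iX := square_integrable_integrable sX.
have iY := square_integrable_integrable sY.
have iXY := square_integrableM sX sY.
pose X' : {mfun Omega >-> R} := HB.pack X (isMeasurableFun.Build _ _ _ _ X mX).
pose Y' : {mfun Omega >-> R} := HB.pack Y (isMeasurableFun.Build _ _ _ _ Y mY).
pose Z o := (X o, Y o).
have mZ : measurable_fun setT Z by exact: measurable_fun_pair.
pose Z' : {mfun Omega >-> (R * R)%type} :=
  HB.pack Z (isMeasurableFun.Build _ _ _ _ Z mZ).
pose f (z : R * R) := (z.1 * z.2)%:E.
have mf : measurable_fun setT f.
  by apply/measurable_EFinP/measurable_funM.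
have law_eq A : measurable A ->
    (distribution P X' \x distribution P Y')%E A = distribution P Z' A.
  apply: product_measure_unique => B C mB mC.
  by rewrite /distribution /= /pushforward -indep.
have if_ : (distribution P X' \x distribution P Y')%E.-integrable setT f.
  apply/integrableP; split=> //.
  rewrite (eq_measure_integral (distribution P Z')); last first.
    by move=> A mA _; exact: law_eq.
  rewrite ge0_integral_distribution//; last exact: measurableT_comp.
  by have /integrableP[] := iXY.
transitivity (\int[distribution P Z']_z f z)%E.
  by rewrite integral_distribution.
rewrite -(eq_measure_integral (distribution P Z') (fun A mA _ => law_eq A mA)).
rewrite -(integral12_prod_meas1 if_).
have mE : measurable_fun [set: R] (fun x : R => x%:E) by exact/measurable_EFinP.
have integrable_id (V : {mfun Omega >-> R}) :
    P.-integrable setT (EFin \o V) ->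
    (distribution P V).-integrable setT (fun x : R => x%:E).
  move=> iV; apply/integrableP; split=> //.
  rewrite ge0_integral_distribution//; last exact: measurableT_comp.
  by have /integrableP[] := iV.
rewrite -(@integral_distribution _ _ _ _ _ P X' _ mE iX).
rewrite -(@integral_distribution _ _ _ _ _ P Y' _ mE iY).
have EY_fin : (\int[distribution P Y']_y y%:E)%E \is a fin_num.
  by apply: integrable_fin_num => //; exact: (integrable_id Y').
rewrite -(fineK EY_fin) -integralZr//; last exact: (integrable_id X').
apply: eq_integral => x _; rewrite fineK// /fubini_F /f /=.
under eq_integral do rewrite EFinM.
by rewrite integralZl//; exact: (integrable_id Y').
Qed.

End SecondMoments.

(** * The stacked form of the policy and of the closed loop *)

Lemma ext0_ord (V : nmodType) (T : nat) (f : 'I_T -> V) (t : 'I_T) :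
  ext0 f t = f t.
Proof. by rewrite /ext0 valK. Qed.

Lemma ext0_geq (V : nmodType) (T : nat) (f : 'I_T -> V) (t : nat) :
  (T <= t)%N -> ext0 f t = 0.
Proof. by move=> le_Tt; rewrite /ext0 insubF// ltnNge le_Tt. Qed.

Section Stacking.
Variables (R : realType) (n m T : nat).

Lemma mxblock_mul_mxcol (p q r k l : nat) (B : 'I_p -> 'I_q -> 'M[R]_(k, r))
    (C : 'I_q -> 'M[R]_(r, l)) :
  (\mxblock_(i < p, j < q) B i j) *m (\mxcol_(j < q) C j) =
  \mxcol_(i < p) \sum_(j < q) B i j *m C j.
Proof.
rewrite mxblockEv mxcol_mul; apply: eq_mxcol => i.
by rewrite mul_mxrow_mxcol.
Qed.

Lemma stack_inj : injective (@stack R n m T).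
Proof.
move=> [u L K] [u' L' K'] [/eq_mxcolP uE /eq_mxcolP LE /eq_mxblockP KE].
have -> : u = u' by apply/funext.
have -> : L = L' by apply/funext.
suff -> : K = K' by [].
apply/functional_extensionality_dep => t; apply/funext => s.
have := KE t (widen_ord (ltnW (ltn_ord t)) s).
by rewrite /= !(ext0_ord _ s).
Qed.

(** The default 0 of [ext0] fills exactly the blocks on and above the diagonal; conversely, the
    gains are read off as the blocks below it. *)
Lemma stack_bij : set_bij [set: policy R n m T]
  [set s : stacked R n m T | strictly_block_lower (st_K s)] (@stack R n m T).
Proof.
split=> [p _ /= i j le_ij|p p' _ _|s /= s_lower].
- by rewrite mxblockK ext0_geq.
- exact: stack_inj.
- pose wid (t : 'I_T) (s : 'I_t) := widen_ord (ltnW (ltn_ord t)) s.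
  exists (Policy (fun t => @submxcol R T (fun=> m) 1 (st_u s) t)
    (fun t => @submxcol R T (fun=> m) n (st_L s) t)
    (fun t r =>
       @submxblock R T T (fun=> m) (fun=> n) (st_K s) t (wid t r))) => //.
  case: s s_lower => u L K /= K_lower; rewrite /stack /=; congr Stacked.
  + exact: submxcolK.
  + exact: submxcolK.
  + rewrite -[RHS](@submxblockK R T T (fun=> m) (fun=> n)).
    apply: eq_mxblock => i j; have [le_ij|lt_ji] := leqP i j.
      by rewrite ext0_geq// K_lower.
    rewrite -[X in ext0 _ X]/(val (Ordinal lt_ji)) ext0_ord.
    by congr submxblock; apply: val_inj.
Qed.

Lemma mxcol_input (mu0 : 'cV[R]_n) (p : policy R n m T) (x0 : 'cV[R]_n)
    (w : 'I_T -> 'cV[R]_n) :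
  \mxcol_(t < T) input mu0 p x0 w t =
  st_u (stack p) + st_L (stack p) *m (x0 - mu0)
  + st_K (stack p) *m (\mxcol_(t < T) w t).
Proof.
rewrite /= mxcol_mul mxblock_mul_mxcol -!mxcolD.
apply: eq_mxcol => t; rewrite /input; congr (_ + _).
rewrite (bigID (fun j : 'I_T => (j < t)%N)) /= [X in _ + X]big1 ?addr0.
  rewrite (big_ord_narrow (ltnW (ltn_ord t))).
  by apply: eq_bigr => s _; rewrite /= (ext0_ord _ s).
by move=> j; rewrite -leqNgt => le_tj; rewrite ext0_geq// mul0mx.
Qed.

Variables (A : 'I_T -> 'M[R]_n) (B : 'I_T -> 'M[R]_(n, m)).

Lemma Phi_id t : Phi A t t = 1%:M.
Proof. by rewrite /Phi /index_iota subnn big_nil. Qed.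

Lemma PhiS s t : (s <= t)%N -> Phi A t.+1 s = ext0 A t *m Phi A t s.
Proof.
move=> le_st; rewrite /Phi /index_iota subSn// -addn1 iotaD rev_cat subnKC//.
by rewrite big_cons.
Qed.

(** Variation of constants. Filtering a sum over ['I_T] by [s < t] matches the zero blocks of [Gu]
    and [Gw]. *)
Lemma stateE (mu0 : 'cV[R]_n) (p : policy R n m T) (x0 : 'cV[R]_n)
    (w : 'I_T -> 'cV[R]_n) (t : nat) : (t <= T)%N ->
  state A B mu0 p x0 w t = Phi A t 0 *m x0 +
  \sum_(s < T | (s < t)%N)
    Phi A t s.+1 *m (B s *m input mu0 p x0 w s + w s).
Proof.
elim: t => [_|t IH lt_tT] /=; first by rewrite Phi_id mul1mx big_pred0 ?addr0.
rewrite IH ?(ltnW lt_tT)// mulmxDr mulmxA -PhiS// -!addrA; congr (_ + _).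
(* The summand at the newest time has transition matrix [Phi A t.+1 t.+1 = 1%:M]: it is the input
   and noise just added. *)
pose t' := Ordinal lt_tT; rewrite [RHS](bigD1 t')//= Phi_id mul1mx addrC.
rewrite -[X in ext0 B X]/(val t') -[X in ext0 (input _ _ _ _) X]/(val t').
rewrite -[X in ext0 w X]/(val t') !ext0_ord; congr (_ + _).
rewrite mulmx_sumr; apply: eq_big => s; last first.
  by move=> lt_st; rewrite PhiS// mulmxA.
by rewrite ltnS -(inj_eq val_inj) /= andbC ltn_neqAle.
Qed.

Lemma Plast_mul (k : nat) (C : 'I_T.+1 -> 'M[R]_(n, k)) :
  Plast R n T *m (\mxcol_(t < T.+1) C t) = C ord_max.
Proof.
rewrite /Plast mul_mxrow_mxcol (bigD1 ord_max)//= eqxx mul1mx big1 ?addr0//.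
by move=> t /negbTE ->; rewrite mul0mx.
Qed.

Lemma terminal_stacked (mu0 : 'cV[R]_n) (p : policy R n m T) (x0 : 'cV[R]_n)
    (w : 'I_T -> 'cV[R]_n) :
  state A B mu0 p x0 w T =
  Plast R n T *m (Gu A B *m st_u (stack p) + G0 A *m mu0) +
  Plast R n T *m row_mx (G0 A + Gu A B *m st_L (stack p))
                        (Gw A + Gu A B *m st_K (stack p))
    *m col_mx (x0 - mu0) (\mxcol_(t < T) w t).
Proof.
have stateP : state A B mu0 p x0 w T = Plast R n T *m
    (G0 A *m x0 + Gu A B *m (\mxcol_(t < T) input mu0 p x0 w t)
     + Gw A *m (\mxcol_(t < T) w t)).
  rewrite /G0 /Gu /Gw mxcol_mul !mxblock_mul_mxcol -!mxcolD Plast_mul stateE//.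
  rewrite -addrA; congr (_ + _); rewrite big_mkcond -big_split /=.
  apply: eq_bigr => s _; rewrite ltn_ord mulmxDr mulmxA.
  by [].
rewrite stateP mxcol_input -mulmxA -mulmxDr; congr (_ *m _).
(* Writing [x0] as [mu0] plus its deviation sends [G0 A *m mu0] to the constant term and the
   deviation to the noise. *)
rewrite mul_row_col -{1}(subrKC mu0 x0); move: (x0 - mu0) (\mxcol_t w t) => e v.
rewrite !mulmxDl !mulmxDr -!mulmxA.
by rewrite [LHS](AC (2*3*1) ((3*1)*((2*4)*(6*5)))).
Qed.

End Stacking.

(** * Expectations of random matrices and moments of affine images *)

Section MatrixExpectation.
Context d (Omega : measurableType d) (R : realType) (P : probability Omega R).

(** Integrability is carried along with linearity, since [fine] is additive only on finite
    values. *)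
Lemma integral_lincomb (I : finType) (c : I -> R) (X : I -> Omega -> R) :
  (forall i, P.-integrable setT (EFin \o X i)) ->
  P.-integrable setT (EFin \o (fun o => \sum_i c i * X i o)) /\
  fine (\int[P]_o (\sum_i c i * X i o)%:E)%E =
  \sum_i c i * fine (\int[P]_o (X i o)%:E)%E.
Proof.
move=> iX; have icX i : P.-integrable setT (fun o => (c i)%:E * (X i o)%:E)%E.
  exact: (integrableZl measurableT (c i) (iX i)).
have sumE : EFin \o (fun o => \sum_i c i * X i o) =
    (fun o => \sum_i (c i)%:E * (X i o)%:E)%E.
  by apply/funext => o; rewrite /= -sumEFin.
split; first by rewrite sumE; exact: integrable_sum.
rewrite -[X in fine X]/(
  \int[P]_o (EFin \o (fun o => (\sum_i c i * X i o)%R)) o)%E sumE.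
rewrite integral_sum//= -sum_fine => [|i _]; last exact: integrable_fin_num.
apply: eq_bigr => i _; rewrite (integralZl measurableT (iX i)) fineM//.
exact: integrable_fin_num.
Qed.

Definition mxintegrable (p q : nat) (Z : Omega -> 'M[R]_(p, q)) :=
  forall i j, P.-integrable setT (EFin \o (fun o => Z o i j)).

Lemma mxexpectationE (p q : nat) (Z : Omega -> 'M[R]_(p, q)) i j :
  mxexpectation P Z i j = fine (\int[P]_o (Z o i j)%:E)%E.
Proof. by rewrite mxE unlock. Qed.

(** Each entry of the product is a linear combination of the entries of [Z], indexed by pairs. The
    two-sided form serves both linear images, with [N = 1%:M], and covariances, with [N = M^T]. *)
Lemma mxexpectation_mul (k p q l : nat) (M : 'M[R]_(k, p))
    (Z : Omega -> 'M[R]_(p, q)) (N : 'M[R]_(q, l)) : mxintegrable Z ->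
  mxintegrable (fun o => M *m Z o *m N) /\
  mxexpectation P (fun o => M *m Z o *m N) = M *m mxexpectation P Z *m N.
Proof.
move=> iZ.
have entryE (Z' : 'M[R]_(p, q)) i j : (M *m Z' *m N) i j =
    \sum_(ab : 'I_p * 'I_q) M i ab.1 * N ab.2 j * Z' ab.1 ab.2.
  rewrite mxE -(pair_bigA _ (fun a b => M i a * N b j * Z' a b)) exchange_big.
  apply: eq_bigr => b _; rewrite mxE mulr_suml; apply: eq_bigr => a _.
  by rewrite mulrAC.
have lin i j := integral_lincomb (fun ab : 'I_p * 'I_q => M i ab.1 * N ab.2 j)
  (fun ab => iZ ab.1 ab.2).
split=> [i j|].
  by under [X in EFin \o X]funext do rewrite entryE; have [] := lin i j.
apply/matrixP => i j; rewrite mxexpectationE entryE.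
under eq_integral do rewrite entryE.
have [_ ->] := lin i j; apply: eq_bigr => ab _.
by rewrite mxexpectationE.
Qed.

Lemma mxexpectation_addl (p q : nat) (C : 'M[R]_(p, q))
    (Z : Omega -> 'M[R]_(p, q)) : mxintegrable Z ->
  mxexpectation P (fun o => C + Z o) = C + mxexpectation P Z.
Proof.
move=> iZ; apply/matrixP => i j; rewrite mxexpectationE mxE mxexpectationE.
under eq_integral do rewrite mxE EFinD.
have icst : P.-integrable setT (EFin \o cst (C i j)).
  exact: finite_measure_integrable_cst.
rewrite (integralD measurableT icst (iZ i j)) fineD; last 2 first.
- exact: integrable_fin_num.
- exact: integrable_fin_num.
by rewrite /= integral_cst//= probability_setT mule1.
Qed.

Section AffineImage.
Variables (k p : nat) (xi : Omega -> 'cV[R]_k) (Q : 'M[R]_k).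
Hypotheses (xi_integrable : mxintegrable xi)
  (xi_centered : mxexpectation P xi = 0)
  (xi2_integrable : mxintegrable (fun o => xi o *m (xi o)^T))
  (xi_covariance : mxexpectation P (fun o => xi o *m (xi o)^T) = Q).
Variables (c : 'cV[R]_p) (M : 'M[R]_(p, k)).

Let Y o := c + M *m xi o.

Lemma mxexpectation_affine : mxexpectation P Y = c.
Proof.
have [iM EM] := mxexpectation_mul M 1%:M xi_integrable.
have NE : (fun o => M *m xi o *m 1%:M) = (fun o => M *m xi o).
  by apply/funext => o; rewrite mulmx1.
rewrite NE in iM; rewrite NE mulmx1 in EM.
by rewrite /Y mxexpectation_addl// EM xi_centered mulmx0 addr0.
Qed.

Lemma mxvariance_affine : mxvariance P Y = M *m Q *m M^T.
Proof.
rewrite /mxvariance mxexpectation_affine /Y -xi_covariance.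
have [_ <-] := mxexpectation_mul M M^T xi2_integrable.
congr (mxexpectation P _); apply/funext => o.
by rewrite addrC addKr trmx_mul !mulmxA.
Qed.

(** The square expands into a constant, a linear term [2 c^T M xi] of mean 0, and a quadratic term
    that is the trace of [M xi xi^T M^T]. *)
Lemma expectation_sqr_affine :
  ('E_P[fun o => (((Y o)^T *m Y o) 0 0)%R] =
   ((c^T *m c) 0 0 + \tr (M *m Q *m M^T))%R%:E)%E.
Proof.
have [iM EM] := mxexpectation_mul (2 *: (c^T *m M)) 1%:M xi_integrable.
have [iMM EMM] := mxexpectation_mul M M^T xi2_integrable.
have [iT ET] := integral_lincomb (fun=> 1) (fun i => iMM i i).
have YE o : ((Y o)^T *m Y o) 0 0 = (c^T *m c) 0 0 +
    (((2 *: (c^T *m M)) *m xi o *m 1%:M) 0 0 +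
     \sum_i 1 * (M *m (xi o *m (xi o)^T) *m M^T) i i).
  have -> : \sum_i 1 * (M *m (xi o *m (xi o)^T) *m M^T) i i =
      ((M *m xi o)^T *m (M *m xi o)) 0 0.
    rewrite -trace_mx11 mxtrace_mulC; apply: eq_bigr => i _.
    by rewrite mul1r trmx_mul !mulmxA.
  rewrite /Y [(c + _)^T]raddfD /= mulmxDl !mulmxDr mulmx1 -scalemxAl !mulmxA.
  have -> : (M *m xi o)^T *m c = c^T *m M *m xi o.
    rewrite -[LHS]trmxK trmx_mul trmxK [X in X^T]mx11_scalar.
    by rewrite tr_scalar_mx -mx11_scalar mulmxA.
  by rewrite !mxE; ring.
rewrite unlock; under eq_integral do rewrite YE EFinD.
have icst : P.-integrable setT (EFin \o cst ((c^T *m c) 0 0)).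
  exact: finite_measure_integrable_cst.
have isum := integrableD measurableT (iM 0 0) iT.
rewrite (integralD measurableT icst isum) (integralD measurableT (iM 0 0) iT).
rewrite /= integral_cst//= probability_setT mule1 EFinD; congr (_ + _)%E.
have -> : (\int[P]_o (((2 *: (c^T *m M)) *m xi o *m 1%:M) 0 0)%R%:E = 0)%E.
  rewrite -[LHS]fineK; last by apply: integrable_fin_num => //; exact: iM.
  by rewrite -mxexpectationE EM xi_centered mulmx0 mul0mx mxE.
rewrite add0e -[LHS]fineK; last by apply: integrable_fin_num => //; exact: iT.
rewrite ET; congr (_%:E); apply: eq_bigr => i _.
by rewrite mul1r -mxexpectationE EMM xi_covariance.
Qed.

End AffineImage.
End MatrixExpectation.

(** * Moments of normal vectors and of independent families *)

(** Open rays generate the Borel sets of the line, and their preimages are open because coordinates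
    are continuous. *)
Lemma borel_cV_coord (R : realType) (n : nat) (i : 'I_n) (A : set R) :
  measurable A -> borel_cV ((fun v : 'cV[R]_n => v i 0) @^-1` A).
Proof.
move=> mA; rewrite -[X in borel_cV X]setTI.
pose cVb := g_sigma_algebraType [set U : set 'cV[R]_n | open U].
have : measurable_fun [set: cVb] (fun v : cVb => (v : 'cV[R]_n) i 0).
  apply: (measurability _ (RGenOInfty.measurableE R)) => _ [_ [x ->] <-].
  rewrite setTI; apply: sub_sigma_algebra => /=.
  apply: open_comp; last exact: interval_open.
  by move=> v _; exact: coord_continuous.
by move=> /(_ measurableT _ mA).
Qed.

Section GaussianVector.
Context d (Omega : measurableType d) (R : realType) (P : probability Omega R).
Variables (n : nat) (z : Omega -> 'cV[R]_n) (mu : 'cV[R]_n) (Sigma : 'M[R]_n).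
Hypotheses (Sigma_psd : psdmx Sigma) (z_normal : normal_vector P z mu Sigma).

Lemma random_vector_coord (i : 'I_n) : measurable_fun setT (fun o => z o i 0).
Proof.
move=> _ A mA; rewrite setTI.
exact: (z_normal.1 _ (borel_cV_coord i mA)).
Qed.

Let Y (a : 'cV[R]_n) o := (a^T *m z o) 0 0 - (a^T *m mu) 0 0.

Let measurable_linear (a : 'cV[R]_n) :
  measurable_fun setT (fun o => (a^T *m z o) 0 0).
Proof.
under eq_fun do rewrite mxE.
apply: measurable_sum => i; apply: measurable_funM; first exact: measurable_cst.
exact: random_vector_coord.
Qed.

Let Ydelta (i : 'I_n) : Y (delta_mx i 0) = fun o => z o i 0 - mu i 0.
Proof.
by apply/funext => o; rewrite /Y trmx_delta -!rowE !mxE.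
Qed.

Lemma normal_vector_square_integrable (i : 'I_n) :
  square_integrable P (fun o => z o i 0 - mu i 0).
Proof.
rewrite -Ydelta; apply: normal_law_square_integrable; last exact: z_normal.2.
- exact: Sigma_psd.2.
- exact: measurable_linear.
Qed.

Lemma normal_vector_centered (i : 'I_n) :
  (\int[P]_o (z o i 0 - mu i 0)%R%:E = 0)%E.
Proof.
have := @normal_law_centered _ _ _ P _ _ _ (Sigma_psd.2 (delta_mx i 0))
  (measurable_linear (delta_mx i 0)) (z_normal.2 (delta_mx i 0)).
by rewrite -[X in (\int[P]_o (X o)%:E)%E]/(Y (delta_mx i 0)) Ydelta.
Qed.

(** Polarization: the variance along [e_i + e_j], minus those along [e_i] and [e_j], is twice the
    covariance on one side and [Sigma i j + Sigma j i] on the other. *)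
Lemma normal_vector_covariance (i j : 'I_n) :
  (\int[P]_o ((z o i 0 - mu i 0) * (z o j 0 - mu j 0))%R%:E = (Sigma i j)%:E)%E.
Proof.
have sqrE (a : 'cV[R]_n) :
    (\int[P]_o (Y a o ^+ 2)%:E = ((a^T *m Sigma *m a) 0 0)%R%:E)%E.
  exact: (@normal_law_sqr _ _ _ P _ _ _ (Sigma_psd.2 a) (measurable_linear a)
    (z_normal.2 a)).
have deltaE (k l : 'I_n) :
    ((delta_mx k 0 : 'cV[R]_n)^T *m Sigma *m (delta_mx l 0 : 'cV[R]_n)) 0 0
    = Sigma k l.
  by rewrite trmx_delta -rowE -colE !mxE.
pose Zi o := z o i 0 - mu i 0; pose Zj o := z o j 0 - mu j 0.
have [mi sqi] := normal_vector_square_integrable i.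
have [mj sqj] := normal_vector_square_integrable j.
have iij := square_integrableM (normal_vector_square_integrable i)
  (normal_vector_square_integrable j).
have i2ij := integrableZl measurableT 2 iij.
have YsumE o : Y (delta_mx i 0 + delta_mx j 0) o = Zi o + Zj o.
  rewrite /Zi /Zj -[z o i 0 - _]/((fun o => z o i 0 - mu i 0) o) -Ydelta.
  rewrite -[z o j 0 - _]/((fun o => z o j 0 - mu j 0) o) -Ydelta /Y.
  by rewrite [(_ + _)^T]raddfD /= !mulmxDl !mxE; ring.
have ij_fin : (\int[P]_o (Zi o * Zj o)%:E)%E \is a fin_num.
  by apply: integrable_fin_num.
have := sqrE (delta_mx i 0 + delta_mx j 0).
under eq_integral.
  move=> o _; rewrite YsumE.
  rewrite (_ : (_ + _) ^+ 2 = Zi o ^+ 2 + (2 * (Zi o * Zj o) + Zj o ^+ 2));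
    last by ring.
  rewrite EFinD (EFinD (2 * _)) (EFinM 2).
  over.
rewrite (integralD measurableT sqi (integrableD measurableT i2ij sqj)).
rewrite (integralD measurableT i2ij sqj) (integralZl measurableT iij).
have := sqrE (delta_mx i 0); rewrite Ydelta deltaE => ->.
have := sqrE (delta_mx j 0); rewrite Ydelta deltaE => ->.
rewrite -[in X in (_ * X)%E](fineK ij_fin) -EFinM -!EFinD => -[].
rewrite [(_ + _)^T]raddfD /= !mulmxDl !mulmxDr.
have addE (M N : 'M[R]_1) : (M + N) 0 0 = M 0 0 + N 0 0 by rewrite mxE.
rewrite !addE !deltaE.
have -> : Sigma j i = Sigma i j by rewrite -{1}Sigma_psd.1 mxE.
move=> sumE; rewrite -[LHS](fineK ij_fin); congr (_%:E).
by lra.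
Qed.

End GaussianVector.

Section Noise.
Context d (Omega : measurableType d) (R : realType) (P : probability Omega R).
Variables (n : nat) (I : finType) (z : I -> Omega -> 'cV[R]_n)
  (mu : I -> 'cV[R]_n) (Sigma : I -> 'M[R]_n).
Hypotheses (Sigma_psd : forall i, psdmx (Sigma i))
  (z_normal : forall i, normal_vector P (z i) (mu i) (Sigma i))
  (z_indep : mutually_independent P z).

Lemma independent_cross_moment (i j : I) (a b : 'I_n) :
  (\int[P]_o ((z i o a 0 - mu i a 0) * (z j o b 0 - mu j b 0))%R%:E =
   (if i == j then Sigma i a b else 0)%:E)%E.
Proof.
have [<-|neq_ij] := eqVneq i j; first exact: normal_vector_covariance.
have sq k c := normal_vector_square_integrable (Sigma_psd k) (z_normal k) c.
rewrite (integral_independent_product (sq i a) (sq j b)); last first.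
  move=> A B mA mB.
  pose shift k c := fun x : R => x - mu k c 0.
  have mshift k c (C : set R) : measurable C -> measurable (shift k c @^-1` C).
    have mf : measurable_fun setT (shift k c) by exact: measurable_funB.
    by move=> mC; have := mf measurableT _ mC; rewrite setTI.
  (* Independence is applied to the index set {i, j}; the second branch matters only at [k = j]. *)
  pose C k := if k == i
    then (fun v : 'cV[R]_n => v a 0) @^-1` (shift i a @^-1` A)
    else (fun v : 'cV[R]_n => v b 0) @^-1` (shift j b @^-1` B).
  have borelC k : borel_cV (C k).
    by rewrite /C; case: ifP => _; apply: borel_cV_coord; exact: mshift.
  have := z_indep [set i; j]%SET borelC.
  rewrite big_setU1 ?inE//= big_set1 /C eqxx eq_sym (negbTE neq_ij).
  move=> <-; congr (P _); apply/seteqP; split => o /=.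
    move=> [Ao Bo] k /=; rewrite !inE => /orP[] /eqP ->; first by rewrite eqxx.
    by rewrite eq_sym (negbTE neq_ij).
  move=> zC; split.
    by have := zC i; rewrite /= !inE eqxx; exact.
  by have := zC j; rewrite /= !inE eqxx orbT eq_sym (negbTE neq_ij); exact.
by rewrite (normal_vector_centered (Sigma_psd i) (z_normal i)) mul0e.
Qed.

End Noise.

(** * Moments of the stacked noise vector *)

Section StackedNoise.
Variables (R : realType) (n T : nat).

(* Every coordinate of [col_mx (x0 - mu0) (\mxcol_t w t)] is a coordinate of
   one of the vectors [x0 - mu0] (index [None]) and [w t] (index [Some t]). *)
Definition noise_index (i : 'I_(n + bdim T n)) : option 'I_T * 'I_n :=
  match fintype.split i with
  | inl a => (None, a)
  | inr k => (Some (tagnat.sig1 k), tagnat.sig2 k)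
  end.

Lemma stacked_noiseE (e : 'cV[R]_n) (v : 'I_T -> 'cV[R]_n) i :
  (col_mx e (\mxcol_(t < T) v t)) i 0 =
  (if (noise_index i).1 is Some t then v t else e) (noise_index i).2 0.
Proof.
rewrite /noise_index -[i in LHS]splitK; case: (fintype.split i) => k /=.
  by rewrite col_mxEu.
by rewrite col_mxEd mxE.
Qed.

Lemma block_covarianceE (Sigma0 W : 'M[R]_n) i j :
  (block_mx Sigma0 0 0 (bigW T W)) i j =
  if (noise_index i).1 == (noise_index j).1
  then (if (noise_index i).1 is Some _ then W else Sigma0)
         (noise_index i).2 (noise_index j).2
  else 0.
Proof.
rewrite /noise_index -[i in LHS]splitK -[j in LHS]splitK.
case: (fintype.split i) => k; case: (fintype.split j) => l /=.
- by rewrite block_mxEul.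
- by rewrite block_mxEur mxE.
- by rewrite block_mxEdl mxE.
- rewrite block_mxEdr mxE -[Some _ == _]/(tagnat.sig1 k == tagnat.sig1 l).
  by case: eqP => _; rewrite ?conform_mx_id// mxE.
Qed.

End StackedNoise.

Section StackedNoiseMoments.
Context d (Omega : measurableType d) (R : realType) (P : probability Omega R).
Variables (n T : nat) (mu0 : 'cV[R]_n) (Sigma0 W : 'M[R]_n).
Hypotheses (Sigma0_psd : psdmx Sigma0) (W_psd : psdmx W).
Variables (x0 : Omega -> 'cV[R]_n) (w : 'I_T -> Omega -> 'cV[R]_n).
Hypotheses (x0_normal : normal_vector P x0 mu0 Sigma0)
  (w_normal : forall t, normal_vector P (w t) 0 W)
  (x0_w_independent : mutually_independent P
     (fun i : option 'I_T => if i is Some t then w t else x0)).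

Definition stacked_noise o := col_mx (x0 o - mu0) (\mxcol_(t < T) w t o).

Let z (i : option 'I_T) := if i is Some t then w t else x0.
Let mu (i : option 'I_T) := if i is Some t then 0 else mu0.
Let Sigma (i : option 'I_T) := if i is Some t then W else Sigma0.

Let Sigma_psd i : psdmx (Sigma i). Proof. by case: i. Qed.
Let z_normal i : normal_vector P (z i) (mu i) (Sigma i).
Proof. by case: i => [t|]; [exact: w_normal|]. Qed.

Let entryE i : (fun o => stacked_noise o i 0) =
  (fun o => z (noise_index i).1 o (noise_index i).2 0
            - mu (noise_index i).1 (noise_index i).2 0).
Proof.
apply/funext => o; rewrite /stacked_noise stacked_noiseE.
by case: (noise_index i) => -[t|] a; rewrite /= !mxE ?subr0.
Qed.

Let square_integrable_entry i :
  square_integrable P (fun o => stacked_noise o i 0).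
Proof.
rewrite entryE.
exact: (normal_vector_square_integrable (Sigma_psd _) (z_normal _)).
Qed.

Lemma stacked_noise_integrable : mxintegrable P stacked_noise.
Proof.
move=> i j; rewrite ord1.
exact: square_integrable_integrable (square_integrable_entry i).
Qed.

Lemma stacked_noise_centered : mxexpectation P stacked_noise = 0.
Proof.
apply/matrixP => i j; rewrite ord1 mxexpectationE mxE.
rewrite -[X in (\int[P]_o (X o)%:E)%E]/(fun o => stacked_noise o i 0) entryE.
by rewrite (normal_vector_centered (Sigma_psd _) (z_normal _)).
Qed.

Let gramE o i j : (stacked_noise o *m (stacked_noise o)^T) i j =
  stacked_noise o i 0 * stacked_noise o j 0.
Proof. by rewrite mxE big_ord1 [X in _ * X]mxE. Qed.

Lemma stacked_noise_gram_integrable :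
  mxintegrable P (fun o => stacked_noise o *m (stacked_noise o)^T).
Proof.
move=> i j; under [X in EFin \o X]funext do rewrite gramE.
exact: square_integrableM (square_integrable_entry i)
  (square_integrable_entry j).
Qed.

Lemma stacked_noise_covariance :
  mxexpectation P (fun o => stacked_noise o *m (stacked_noise o)^T) =
  block_mx Sigma0 0 0 (bigW T W).
Proof.
apply/matrixP => i j; rewrite mxexpectationE block_covarianceE.
have entryP k o : stacked_noise o k 0 =
    z (noise_index k).1 o (noise_index k).2 0
    - mu (noise_index k).1 (noise_index k).2 0.
  by have /(congr1 (@^~ o)) := entryE k.
under eq_integral do rewrite gramE !entryP.
by rewrite (independent_cross_moment Sigma_psd z_normal x0_w_independent).
Qed.

End StackedNoiseMoments.

(** * Equivalence of the two optimization problems *)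

Theorem theorem2 (R : realType) (d : measure_display) (Omega : measurableType d)
    (P : probability Omega R) (n m T q : nat) (T_ge1 : (1 <= T)%N)
    (A : 'I_T -> 'M[R]_n) (B : 'I_T -> 'M[R]_(n, m))
    (mu0 : 'cV[R]_n) (Sigma0 W : 'M[R]_n)
    (Sigma0_pd : pdmx Sigma0) (W_psd : psdmx W)
    (x0 : Omega -> 'cV[R]_n) (w : 'I_T -> Omega -> 'cV[R]_n)
    (x0_normal : normal_vector P x0 mu0 Sigma0)
    (w_normal : forall t : 'I_T, normal_vector P (w t) 0 W)
    (x0_w_independent : mutually_independent P
       (fun i : option 'I_T => if i is Some t then w t else x0))
    (Rm : 'M[R]_(n + bdim T n, q))
    (RmE : Rm *m Rm^T = block_mx Sigma0 0 0 (bigW T W))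
    (mud : 'cV[R]_n) (Sigmad : 'M[R]_n) (Sigmad_pd : pdmx Sigmad)
    (rho : R) (rho_gt0 : 0 < rho) :
  let SCCS := @sccs_feasible d Omega R P n m T mu0 x0 w rho in
  let J := @sccs_objective d Omega R P n m T A B mu0 x0 w mud Sigmad in
  let NLP := @nlp_feasible R n m T q A B Sigma0 W Rm rho in
  let J' := @nlp_objective R n m T q A B mu0 mud Sigmad in
  let phi := @to_nlp R n m T q A B Rm in
  [/\ set_bij [set: policy R n m T]
        [set s : stacked R n m T | strictly_block_lower (st_K s)] (@stack R n m T),
      forall p : policy R n m T, SCCS p <-> NLP (phi p),
      forall p : policy R n m T, J p = J' (phi p),
      optimal_value SCCS J = optimal_value NLP J' &
      minimizers NLP J' = phi @` minimizers SCCS J].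
Proof.
move=> SCCS J NLP J' phi.
have Sigma0_psd : psdmx Sigma0.
  split=> [|v]; first exact: Sigma0_pd.1.
  have [->|v_neq0] := eqVneq v 0; first by rewrite mulmx0 mxE.
  exact/ltW/Sigma0_pd.2.
have xi_int := stacked_noise_integrable Sigma0_psd W_psd x0_normal w_normal.
have xi_E := stacked_noise_centered Sigma0_psd W_psd x0_normal w_normal.
have xi2_int :=
  stacked_noise_gram_integrable Sigma0_psd W_psd x0_normal w_normal.
have xi_cov := stacked_noise_covariance Sigma0_psd W_psd x0_normal w_normal
  x0_w_independent.
have stackP := stack_bij R n m T.
have stack_lower (p : policy R n m T) :
    strictly_block_lower (st_K (stack p)).
  by have [stack_sub _ _] := stackP; exact: (stack_sub p I).
have feasible p : SCCS p <-> NLP (phi p).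
  have energyE : input_energy mu0 x0 w p = fun o =>
      (((st_u (stack p) + row_mx (st_L (stack p)) (st_K (stack p))
           *m stacked_noise mu0 x0 w o)^T
        *m (st_u (stack p) + row_mx (st_L (stack p)) (st_K (stack p))
           *m stacked_noise mu0 x0 w o)) 0 0).
    apply/funext => o; rewrite /stacked_noise mul_row_col addrA -mxcol_input.
    by rewrite tr_mxcol mul_mxrow_mxcol summxE.
  have costE : 'E_P[input_energy mu0 x0 w p]%E =
      (((st_u (stack p))^T *m st_u (stack p)) 0 0
       + \tr (st_K (stack p) *m bigW T W *m (st_K (stack p))^T)
       + \tr (st_L (stack p) *m Sigma0 *m (st_L (stack p))^T))%:E.
    rewrite energyE (expectation_sqr_affine xi_int xi_E xi2_int xi_cov).
    (* The noise covariance is block diagonal, so no term mixes [L] and [K]. *)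
    rewrite mul_row_block !mulmx0 addr0 add0r tr_row_mx mul_row_col mxtraceD.
    by rewrite addrA addrAC.
  rewrite /SCCS /NLP /sccs_feasible /nlp_feasible /= costE -EFinB lee_fin.
  by split=> [cost_le|[_ _]//]; split=> //; exact: stack_lower.
have objective p : J p = J' (phi p).
  pose M := Plast R n T *m row_mx (G0 A + Gu A B *m st_L (stack p))
                                  (Gw A + Gu A B *m st_K (stack p)).
  have terminalE : terminal_state A B mu0 x0 w p = fun o =>
      Plast R n T *m (Gu A B *m st_u (stack p) + G0 A *m mu0)
      + M *m stacked_noise mu0 x0 w o.
    by apply/funext => o; exact: terminal_stacked.
  rewrite /J /sccs_objective terminalE (mxexpectation_affine xi_int xi_E).
  rewrite (mxvariance_affine xi_int xi_E xi2_int xi_cov) -RmE.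
  have -> : M *m (Rm *m Rm^T) *m M^T = (M *m Rm) *m (M *m Rm)^T.
    by move: M {terminalE} => M; rewrite trmx_mul !mulmxA.
  exact: wasserstein2_gram.
(* The structural constraints put every feasible point in the range of [phi], by surjectivity of
   stacking. Equality of the optimal values and the correspondence of minimizers follow from this
   image identity and the equality of objectives. *)
have phi_feasible : NLP = phi @` SCCS.
  apply/seteqP; split=> [[s xi] sP|_ [p pP <-]]; last exact/feasible.
  have [s_lower xiE _] := sP.
  have [_ _ /(_ s s_lower)[p _ sE]] := stackP.
  have phiE : phi p = (s, xi) by rewrite /phi /to_nlp sE xiE.
  by exists p => //; apply/feasible; rewrite phiE.
split=> //.
- rewrite /optimal_value phi_feasible image_comp; congr ereal_inf.
  by apply: eq_imagel => p _; rewrite /= objective.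
- rewrite /minimizers; apply/seteqP; split=> [v [vP v_min]|_ [p [pP p_min] <-]].
    move: (vP); rewrite phi_feasible => -[p pP vE].
    exists p; last exact: vE.
    split=> [|r rP]; first exact: pP.
    rewrite (objective p) (objective r) vE.
    by apply: v_min; exact/feasible.
  split; first exact/feasible.
  move=> v; rewrite phi_feasible => -[r rP <-].
  by rewrite -(objective p) -(objective r); exact: p_min.
Qed.
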